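(* For each integer $n\ge 0$, let $P_n$ denote the number of permutations of the set $\{1,2,\dots,n\}$ all of whose cycle lengths are prime numbers (with $P_0=1$). Let $$c=\gamma-\sum_{p}\log\left(\frac{1}{1-1/p}-\frac{1}{p}\right),$$ where the sum is over all prime numbers $p$ and $\gamma$ is the Euler--Mascheroni constant. Then $$\sum_{k=0}^{n}\frac{P_k}{k!}\sim e^{c}\log n \quad\text{as } n\to\infty,$$ i.e. the ratio of the left-hand side to $e^{c}\log n$ tends to $1$.
   Context: Equivalently, $\sum_{n\ge 0} P_n z^n/n! = \exp\left(\sum_p z^p/p\right)$, the sum over all primes $p$. The constant $c$ is the constant for which $\sum_{p\le y}1/p=\log\log y+c+O(1/\log y)$ as $y\to\infty$; numerically $c\approx 0.261497$ and $e^c\approx 1.298873$.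
   Formalization: The constant is taken as c = γ − Σ_p (log(1/(1−1/p)) − 1/p), with 1/p subtracted outside the logarithm (c ≈ 0.2615); the formula as displayed gives a negative number, for which the claim is false. *)

(* Defs.v *)
From mathcomp Require Import all_boot all_order all_algebra all_fingroup.
From mathcomp Require Import all_classical all_reals all_analysis.
Import Order.TTheory GRing.Theory Num.Theory.
Import numFieldNormedType.Exports.

Set Implicit Arguments.
Unset Strict Implicit.
Unset Printing Implicit Defensive.

Local Open Scope classical_set_scope.
Local Open Scope ring_scope.

(* [porbits s] is the set of supports of the cycles of [s], including the
   singletons of the fixed points, which count as cycles of length 1. *)
Definition prime_cycle_perms (n : nat) : {set 'S_n} :=
  [set s : 'S_n | [forall C in porbits s, prime #|C|]]%SET.

Definition P (n : nat) : nat := #|prime_cycle_perms n|.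

(* [series harmonic n] is 1 + 1/2 + ... + 1/n. *)
Definition euler_gamma (R : realType) : R :=
  limn (fun n : nat => series harmonic n - ln (n%:R : R)).

(* The 1/p is subtracted outside the logarithm: this is the constant c for
   which \sum_(p <= y) 1/p = ln (ln y) + c + O(1 / ln y), c = 0.261497...
   Subtracting it inside, ln (1 / (1 - 1/p) - 1/p), would give a different
   (negative) number. *)
Definition mertens_c (R : realType) : R :=
  euler_gamma R
  - limn (fun n : nat => \sum_(0 <= p < n | prime p)
            (ln (1 / (1 - 1 / (p%:R : R))) - 1 / p%:R)).

(* Main.v *)
(** Write a_k = P_k/k!, S_n = a_0 + ... + a_n and A(n) for the sum of 1/p over
    the primes p <= n. Splitting a permutation at the cycle of a fixed point
    gives n a_n = sum over p <= n of a_(n-p), so that the a_k with k <= n are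
    the coefficients of exp(g_n), where g_n(x) is the sum of x^p/p over p <= n.
    Evaluating at x = 1 gives S_n <= exp(A(n)); evaluating at x = exp(-T/n) and
    bounding the coefficients beyond x^n by their sum at 1 gives
      S_n >= exp(A(n)) (exp(-T pi(n)/n) - exp(-T)).
    Since pi(n)/n tends to 0, S_n ~ exp(A(n)), with no Tauberian theorem.

    It remains to prove A(n) = ln ln n + c + o(1), and since S_n is monotone the
    powers n = 2^K suffice. Legendre's formula and Chebyshev's bound give
    sum_(p <= 2^K) (ln p)/p = K ln 2 + O(1); by partial summation
    D_K = A(2^K) - (1 + 1/2 + ... + 1/K) converges to some L. Abel's theorem
    identifies L: with x = 2^(-d), the sum of (D_(k+1) - D_k) x^(k+1) differs by
    o(1), as d -> 0, from the sum of p^(-1-d) over all primes plus ln(1 - x), and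
    the Euler product and d zeta(1+d) -> 1 evaluate that. As the harmonic sum is
    ln K + gamma + o(1), the Euler constant enters without a Gamma integral. *)

Require Import Defs.
From mathcomp Require Import all_boot all_order all_algebra all_fingroup.

Set Implicit Arguments.
Unset Strict Implicit.
Unset Printing Implicit Defensive.

(** * Permutations with prescribed cycle lengths *)

Section PermutationsByCycleLength.
Local Open Scope group_scope.
Variable T : finType.
Implicit Types (s u v : {perm T}) (A C D : {set T}) (x z : T) (W : pred nat).

(** Working with subsets [A] of a fixed type, rather than with ['S_n], means that removing a cycle
    leaves an object of the same kind. *)
Definition perms_cycle_in W A : {set {perm T}} :=
  [set s | perm_on A s & [forall z in A, W #|porbit s z|]].

(** For [x] in [C] these are the permutations forming a single cycle on [C]. *)
Definition full_cycles x C : {set {perm T}} :=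
  [set u | perm_on C u & porbit u x == C].

Lemma eq_porbit_on s u D z :
  {in D, forall y, u y \in D} -> {in D, s =1 u} -> z \in D ->
  porbit s z = porbit u z.
Proof.
move=> uD su zD.
have E i : (s ^+ i) z = (u ^+ i) z /\ (u ^+ i) z \in D.
  elim: i => [|i [IH1 IH2]]; first by rewrite !expg0 perm1.
  by rewrite !expgSr !permM IH1 su //; split=> //; apply: uD.
apply/porbit_setP => y; apply/porbitP/porbitP => -[i ->]; exists i;
  by case: (E i).
Qed.

Lemma porbit_sub s A z : perm_on A s -> z \in A -> porbit s z \subset A.
Proof.
move=> sA zA; apply/subsetP => y /porbitP [i ->] {y}.
elim: i => [|i IH]; first by rewrite expg0 perm1.
by rewrite expgSr permM perm_closed.
Qed.


Section Splitting.
Variables (A C : {set T}) (u v : {perm T}).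
Hypotheses (uC : perm_on C u) (vD : perm_on (A :\: C) v).

Lemma split_permE : {in C, u * v =1 u}.
Proof.
move=> z zC; rewrite permM (out_perm vD) // inE.
by rewrite (perm_closed _ uC) zC.
Qed.

Lemma split_permD : {in A :\: C, u * v =1 v}.
Proof.
by move=> z; rewrite inE => /andP[zC _]; rewrite permM (out_perm uC).
Qed.

Lemma porbit_split_permC : {in C, porbit (u * v) =1 porbit u}.
Proof.
move=> z zC; apply: (eq_porbit_on (D := C)) => //; last exact: split_permE.
by move=> y; rewrite (perm_closed _ uC).
Qed.

Lemma porbit_split_permD : {in A :\: C, porbit (u * v) =1 porbit v}.
Proof.
move=> z zC; apply: (eq_porbit_on (D := A :\: C)) => //; last exact: split_permD.
by move=> y; rewrite (perm_closed _ vD).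
Qed.

End Splitting.

(** If the orbit of [x] is [C], then [s] preserves [C] and factors as its restriction to [C] times a
    permutation of [A :\: C]. Conversely, factors with disjoint supports keep their own orbits. *)
Lemma perms_cycle_in_splitE W A C x : C \subset A -> x \in C -> W #|C| ->
  [set s in perms_cycle_in W A | porbit s x == C] =
  [set w.1 * w.2 | w in setX (full_cycles x C) (perms_cycle_in W (A :\: C))].
Proof.
move=> CA xC WC; apply/setP=> s; rewrite !inE; apply/andP/imsetP.
  case=> /andP[sA sW] /eqP sx.
  have sC z : (s z \in C) = (z \in C).
    by rewrite -sx !(porbit_sym s _ x) -(porbit_perm s 1 z) expg1.
  have sN : s \in 'N(C | 'P).
    by apply/astabsP => z; rewrite /= apermE sC.
  pose u := restr_perm C s.
  have uC : perm_on C u := restr_perm_on C s.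
  have us : {in C, u =1 s} by move=> z zC; rewrite /u restr_permE.
  have uxC : porbit u x = C.
    by rewrite -[RHS]sx; apply: (eq_porbit_on (D := C)) => // y; rewrite sC.
  have svC z : z \in C -> (u^-1 * s) z = z.
    move=> zC; rewrite permM -us ?permKV //.
    by rewrite (perm_closed _ (perm_onV uC)).
  have vD : perm_on (A :\: C) (u^-1 * s).
    apply/subsetP => z; rewrite inE => zN; rewrite inE.
    have zC : z \notin C by apply: contra zN => /svC ->.
    rewrite zC /=; apply: contraR zN => zA.
    by rewrite permM (out_perm (perm_onV uC) zC) (out_perm sA zA).
  have E : s = u * (u^-1 * s) by rewrite mulgA mulgV mul1g.
  exists (u, u^-1 * s); last by rewrite /= -E.
  rewrite !inE uC uxC eqxx vD /=.
  apply/forallP => z; apply/implyP => zD.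
  rewrite -(porbit_split_permD uC vD) // -E.
  by move/forallP: sW => /(_ z); move: zD; rewrite inE => /andP[_ ->].
case=> -[u v]; rewrite !inE /= => /andP[/andP[uC /eqP ux] /andP[vD vW]] ->.
rewrite (porbit_split_permC uC vD) // ux eqxx; split => //.
apply/andP; split.
  apply: perm_onM; last by apply: subset_trans vD _; rewrite subsetDl.
  by apply: subset_trans uC _.
apply/forallP => z; apply/implyP => zA; case: (boolP (z \in C)) => zC.
  rewrite (porbit_split_permC uC vD) //.
  suff -> : porbit u z = porbit u x by rewrite ux.
  by apply/eqP; rewrite eq_porbit_mem ux.
rewrite (porbit_split_permD uC vD) ?inE ?zC //.
by move/forallP: vW => /(_ z); rewrite inE zC zA.
Qed.

Lemma card_perms_cycle_in_split W A C x : C \subset A -> x \in C -> W #|C| ->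
  #|[set s in perms_cycle_in W A | porbit s x == C]| =
  (#|full_cycles x C| * #|perms_cycle_in W (A :\: C)|)%N.
Proof.
move=> CA xC WC; rewrite perms_cycle_in_splitE // card_in_imset ?cardsX //.
move=> [u v] [u' v']; rewrite !inE /=.
move=> /andP[/andP[uC _] /andP[vD _]] /andP[/andP[uC' _] /andP[vD' _]] E.
have uu : u = u'.
  apply/permP => z; case: (boolP (z \in C)) => zC; last first.
    by rewrite (out_perm uC zC) (out_perm uC' zC).
  by rewrite -(split_permE uC vD zC) E (split_permE uC' vD' zC).
by move: E; rewrite uu => /mulgI ->.
Qed.

Lemma card_perms_cycle_in_orbit W A x : x \in A ->
  #|perms_cycle_in W A| =
  \sum_(C : {set T} | (C \subset A) && (x \in C) && W #|C|)
    (#|full_cycles x C| * #|perms_cycle_in W (A :\: C)|)%N.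
Proof.
move=> xA; rewrite -sum1_card.
rewrite (partition_big (fun s => porbit s x)
  (fun C => (C \subset A) && (x \in C) && W #|C|)) /=.
  apply: eq_bigr => C /andP[/andP[CA xC] WC].
  rewrite -card_perms_cycle_in_split // -sum1_card.
  by apply: eq_bigl => s; rewrite inE.
move=> s; rewrite inE => /andP[sA /forallP/(_ x)]; rewrite xA /= => ->.
by rewrite porbit_sub // porbit_id.
Qed.

(** Removing [x] from [C] leaves an arbitrary subset of [A :\ x]; hence the binomial over [#|A|.-1]
    and the shift to [j.+1]. *)
Lemma sum_subsets_by_size (F : nat -> nat) A x : x \in A ->
  \sum_(C : {set T} | (C \subset A) && (x \in C)) F #|C| =
  \sum_(j < #|A|) ('C(#|A|.-1, j) * F j.+1)%N.
Proof.
move=> xA.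
have cA : #|A| = #|A :\ x|.+1 by rewrite (cardsD1 x A) xA.
rewrite (reindex_onto (fun D => x |: D) (fun C => C :\ x)) /=; last first.
  by move=> C /andP[_ xC]; rewrite setD1K.
transitivity (\sum_(D : {set T} | D \subset A :\ x) F #|D|.+1).
  apply: eq_big => D.
    rewrite setU11 andbT subUset sub1set xA /= subsetD1.
    case: (D \subset A) => //=; apply/eqP/idP => [<-|xD].
      by rewrite !inE eqxx.
    by rewrite setU1K.
  rewrite setU11 andbT subUset sub1set xA /= => /andP[_ /eqP DE].
  by rewrite cardsU1 -DE !inE eqxx.
rewrite cA /= (partition_big (fun D : {set T} => inord #|D| : 'I_(#|A :\ x|.+1))
   predT) //=.
apply: eq_bigr => j _; rewrite -cards_draws -[X in (X * _)%N]sum1_card big_distrl /=.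
apply: eq_big => D.
  rewrite inE; case DA : (D \subset A :\ x) => //=.
  by rewrite -val_eqE /= inordK // ltnS subset_leq_card.
by move=> /andP[DA /eqP <-]; rewrite inordK ?ltnS ?subset_leq_card // mul1n.
Qed.

Lemma perms_cycle_in_predT A : #|perms_cycle_in predT A| = #|A|`!.
Proof.
rewrite -card_perm; apply: eq_card => s; rewrite inE unfold_in.
by apply/andb_idr => _; apply/forallP => z; rewrite implybT.
Qed.


(* Comparing [#|C|`!] with the orbit decomposition of all permutations of [C]
   leaves one unknown term, the number of full cycles on [C]. *)
Lemma card_full_cycles C x : x \in C -> #|full_cycles x C| = #|C|.-1`!.
Proof.
have [n] := ubnP #|C|; elim: n C => // n IH C leCn xC.
have := card_perms_cycle_in_orbit predT xC.
rewrite (bigD1 C) ?subxx ?xC //= setDv !perms_cycle_in_predT cards0 muln1.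
set S := (X in (_ + X)%N).
have [m cC] : exists m, #|C| = m.+1 by exists #|C|.-1; rewrite prednK // (cardsD1 x) xC.
(* Each size [j.+1] with [j < m] contributes C(m, j) j! (m - j)! = m!, so the orbits other than [C]
   account for m m! of the (m + 1)! permutations. *)
have -> : S = (m * m`!)%N.
  pose G j := if (j == #|C|) then 0%N else (j.-1`! * (#|C| - j)`!)%N.
  transitivity (\sum_(D : {set T} | (D \subset C) && (x \in D)) G #|D|).
    rewrite [RHS](bigD1 C) ?subxx //= {1}/G eqxx add0n.
    apply: eq_big => D; first by rewrite andbT.
    move=> /andP[/andP[/andP[DC xD] _] neD].
    have ltD : (#|D| < #|C|)%N by rewrite proper_card // properEneq neD.
    rewrite IH //; last exact: leq_trans ltD _.
    by rewrite perms_cycle_in_predT cardsD (setIidPr DC) /G ltn_eqF.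
  rewrite sum_subsets_by_size // /G cC big_ord_recr /= eqxx muln0 addn0.
  rewrite -[X in (X * _)%N]card_ord -sum_nat_const; apply: eq_bigr => j _.
  by rewrite eqSS ltn_eqF //= subSS bin_fact // ltnW.
by rewrite cC factS mulSn => /eqP; rewrite eqn_add2r => /eqP <-.
Qed.

End PermutationsByCycleLength.

Lemma prime_cycle_permsE n : prime_cycle_perms n = perms_cycle_in prime [set: 'I_n].
Proof.
apply/setP => s; rewrite !inE; apply/forallP/andP => [H|[_ /forallP H] C].
  split; first by apply/subsetP => z; rewrite inE.
  apply/forallP => z; have := H (porbit s z); rewrite imset_f //= => ->.
  by rewrite implybT.
by apply/implyP => /imsetP[z _ ->]; have := H z; rewrite inE.
Qed.

(** Once summed by size, the orbit recurrence is the same for [A] and for ['I_#|A|]. Letting the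
    induction range over all finite types replaces transport along a bijection. *)
Lemma card_perms_prime_cycle_in (T : finType) (A : {set T}) :
  #|perms_cycle_in prime A| = P #|A|.
Proof.
have [n] := ubnP #|A|; elim: n T A => // n IH T A leAn.
have rec (T' : finType) (A' : {set T'}) x : #|A'| = #|A| -> x \in A' ->
  #|perms_cycle_in prime A'| = \sum_(C : {set T'} | (C \subset A') && (x \in C))
   (if prime #|C| then #|C|.-1`! * P (#|A| - #|C|) else 0)%N.
  move=> cA xA; rewrite (card_perms_cycle_in_orbit _ xA) big_mkcondr /=.
  apply: eq_bigr => C /andP[CA xC]; case: ifP => // _.
  have C0 : 0 < #|C| by rewrite (cardsD1 x) xC.
  have CA' := subset_leq_card CA.
  have cAC : #|A' :\: C| = (#|A| - #|C|)%N by rewrite cardsD (setIidPr CA) cA.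
  rewrite card_full_cycles // IH cAC // -cA.
  by apply: leq_trans (_ : #|A'| <= n); [rewrite ltn_subrL C0 (leq_trans C0)|rewrite cA].
rewrite /P prime_cycle_permsE.
have [A0|[x xA]] := set_0Vmem A.
  have E (T' : finType) (A' : {set T'}) : #|A'| = 0 -> #|perms_cycle_in prime A'| = 1.
    move=> /eqP; rewrite cards_eq0 => /eqP ->.
    rewrite -(cards1 (1 : {perm T'})%g); apply: eq_card => s; rewrite !inE.
    apply/andP/eqP => [[s0 _]|->]; first by apply: perm_on_id s0 _; rewrite cards0.
    by split; [apply: perm_on1|apply/forallP => z; rewrite inE].
  by rewrite !E // ?cardsT ?card_ord A0 cards0.
have cI : #|[set: 'I_#|A|]| = #|A| by rewrite cardsT card_ord.
have A0 : 0 < #|A| by rewrite (cardsD1 x) xA.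
rewrite (rec _ _ _ _ xA) // (rec _ _ (Ordinal A0)) ?inE //.
by rewrite !(sum_subsets_by_size (fun j => if prime j then j.-1`! * P (#|A| - j) else 0)%N)
  ?inE ?cI.
Qed.

Lemma P0 : P 0 = 1.
Proof.
have := card_perms_prime_cycle_in (set0 : {set 'I_0}); rewrite cards0 => <-.
rewrite -(cards1 (1 : 'S_0)%g); apply: eq_card => s; rewrite !inE.
apply/andP/eqP => [[s0 _]|->]; first by apply: perm_on_id s0 _; rewrite cards0.
by split; [apply: perm_on1|apply/forallP => z; rewrite inE].
Qed.

(** Choose the [j] other elements of the cycle through [ord0], one of the j! cycles on them, and a
    permutation of the rest. *)
Lemma P_rec n :
  P n.+1 = \sum_(j < n.+1) ('C(n, j) * (if prime j.+1 then j`! * P (n - j) else 0))%N.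
Proof.
have cI : #|[set: 'I_n.+1]| = n.+1 by rewrite cardsT card_ord.
rewrite -{1}cI -card_perms_prime_cycle_in (card_perms_cycle_in_orbit _ (in_setT ord0)).
rewrite big_mkcondr /=.
transitivity (\sum_(C : {set 'I_n.+1} | (C \subset [set: 'I_n.+1]) && (ord0 \in C))
   (if prime #|C| then #|C|.-1`! * P (n.+1 - #|C|) else 0)%N).
  apply: eq_bigr => C /andP[CA xC]; case: ifP => // _.
  by rewrite card_full_cycles // card_perms_prime_cycle_in cardsD (setIidPr CA) cI.
by rewrite (sum_subsets_by_size (fun j => if prime j then j.-1`! * P (n.+1 - j) else 0)%N)
  ?inE // cI /=.
Qed.

From mathcomp Require Import all_classical all_reals all_analysis.
From mathcomp Require Import ring lra zify.
Import Order.TTheory GRing.Theory Num.Theory.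
Import numFieldNormedType.Exports.

Local Open Scope classical_set_scope.
Local Open Scope ring_scope.

(** * The exponential of the prime polynomial *)

(** A polynomial stand-in for the power series exp(p): if [p] has no constant term, the powers p^m
    with m > k do not reach x^k, so the coefficients of index below [M] are exact. *)
Definition truncated_exp (R : realType) (M : nat) (p : {poly R}) : {poly R} :=
  \sum_(m < M) (m`!%:R)^-1 *: p ^+ m.

Definition prime_poly (R : realType) (n : nat) : {poly R} :=
  \poly_(i < n.+1) (if prime i then i%:R^-1 else 0).

Definition prime_recip_sum (R : realType) (n : nat) : R :=
  \sum_(0 <= p < n.+1 | prime p) p%:R^-1.

Section TruncatedExponential.
Variable R : realType.
Implicit Types (p : {poly R}) (x : R).

Lemma deriv_truncated_exp M p :
  (truncated_exp M.+1 p)^`() = truncated_exp M p * p^`().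
Proof.
rewrite /truncated_exp big_ord_recl expr0 derivD derivZ derivC scaler0 add0r.
rewrite raddf_sum mulr_suml; apply: eq_bigr => i _.
rewrite /= derivZ deriv_exp /= /bump /= add1n -scalerAl -[_ *+ i.+1]scaler_nat.
rewrite scalerA [p^`() * _]mulrC factS natrM invfM [_^-1 * _^-1]mulrC -mulrA.
by rewrite mulVf ?pnatr_eq0 // mulr1.
Qed.

Lemma coef0_truncated_exp M p : p`_0 = 0 -> (truncated_exp M.+1 p)`_0 = 1.
Proof.
move=> p0; rewrite /truncated_exp big_ord_recl expr0 coefD coefZ coef1 fact0 invr1.
rewrite mul1r coef_sum big1 ?addr0 // => i _.
by rewrite coefZ -horner_coef0 horner_exp horner_coef0 p0 expr0n /= mulr0.
Qed.

Lemma horner_truncated_exp M p x :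
  (truncated_exp M p).[x] = series (exp_coeff p.[x]) M.
Proof.
rewrite seriesEord /truncated_exp horner_sum; apply: eq_bigr => m _.
by rewrite hornerZ horner_exp mulrC.
Qed.

Lemma series_exp_coeff_le_expR M x : 0 <= x -> series (exp_coeff x) M <= expR x.
Proof.
move=> x0; apply: nondecreasing_cvgn_le; last exact: is_cvg_series_exp_coeff.
by apply: nondecreasing_series => i _ _; apply: exp_coeff_ge0.
Qed.

Lemma coef_prime_poly0 n : (prime_poly R n)`_0 = 0.
Proof. by rewrite coef_poly. Qed.

Lemma coef_deriv_prime_poly n i :
  (prime_poly R n)^`()`_i = ((i < n)%N && prime i.+1)%:R.
Proof.
rewrite coef_deriv coef_poly ltnS; case: ltnP => //= _; last by rewrite mul0rn.
by case: ifP => _; rewrite ?mul0rn // -[LHS]mulr_natr mulVf ?pnatr_eq0.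
Qed.

Lemma horner_prime_poly n x :
  (prime_poly R n).[x] = \sum_(0 <= p < n.+1 | prime p) p%:R^-1 * x ^+ p.
Proof.
rewrite horner_poly big_mkord [RHS]big_mkcond /=; apply: eq_bigr => i _.
by case: ifP; rewrite // mul0r.
Qed.

Lemma horner_prime_poly1 n : (prime_poly R n).[1] = prime_recip_sum R n.
Proof.
by rewrite horner_prime_poly; apply: eq_bigr => p _; rewrite expr1n mulr1.
Qed.

Lemma horner_prime_poly_ge0 n x : 0 <= x -> 0 <= (prime_poly R n).[x].
Proof.
move=> x0; rewrite horner_prime_poly; apply: sumr_ge0 => p _.
by rewrite mulr_ge0 ?invr_ge0 ?ler0n ?exprn_ge0.
Qed.

(** [a] stands for P_k/k!, of which only the initial value and the recurrence are used here. *)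
Variable a : nat -> R.
Hypothesis a0 : a 0%N = 1.
Hypothesis a_rec : forall n,
  n.+1%:R * a n.+1 = \sum_(j < n.+1) (prime j.+1)%:R * a (n - j)%N.

Lemma prime_rec_ge0 n : 0 <= a n.
Proof.
have [m] := ubnP n; elim: m n => // m IH [|n] nm; first by rewrite a0.
rewrite -(pmulr_rge0 _ (ltr0Sn _ n)) a_rec; apply: sumr_ge0 => j _.
by rewrite mulr_ge0 ?ler0n // IH // (leq_ltn_trans (leq_subr _ _)).
Qed.

(** Coefficients of E' = E g': this is the recurrence of [a], with the primes above [n] dropped and
    the truncation order lowered by one. *)
Lemma coef_truncated_exp_rec n M k :
  k.+1%:R * (truncated_exp M.+1 (prime_poly R n))`_k.+1 =
  \sum_(j < k.+1) ((j < n)%N && prime j.+1)%:R *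
    (truncated_exp M (prime_poly R n))`_(k - j).
Proof.
rewrite mulr_natl -coef_deriv deriv_truncated_exp coefMr.
by apply: eq_bigr => j _; rewrite coef_deriv_prime_poly mulrC.
Qed.

Lemma coef_truncated_exp_ge0 n M k : 0 <= (truncated_exp M (prime_poly R n))`_k.
Proof.
rewrite /truncated_exp coef_sum; apply: sumr_ge0 => m _.
rewrite coefZ mulr_ge0 ?invr_ge0 ?ler0n //.
elim: (m : nat) k => [|i IH] k; first by rewrite expr0 coef1 ler0n.
rewrite exprS coefM; apply: sumr_ge0 => j _; rewrite mulr_ge0 //.
by rewrite coef_poly; case: ifP => // _; case: ifP => // _; rewrite invr_ge0.
Qed.

Lemma coef_truncated_exp_le n M k : (truncated_exp M (prime_poly R n))`_k <= a k.
Proof.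
have [m] := ubnP k; elim: m k M => // m IH k [|M] km.
  by rewrite /truncated_exp big_ord0 coef0 prime_rec_ge0.
case: k km => [|k] km; first by rewrite coef0_truncated_exp ?coef_prime_poly0 ?a0.
rewrite -(ler_pM2l (ltr0Sn _ k)) a_rec coef_truncated_exp_rec.
apply: ler_sum => j _; apply: ler_pM => //; rewrite ?coef_truncated_exp_ge0 //.
  by case: (j < n)%N; rewrite //= ler0n.
by rewrite IH // (leq_ltn_trans (leq_subr _ _)).
Qed.

Lemma coef_truncated_exp_eq n M k : (k <= n)%N -> (k < M)%N ->
  (truncated_exp M (prime_poly R n))`_k = a k.
Proof.
have [m] := ubnP k; elim: m k M => // m IH k [|M] // km kn kM.
case: k km kn kM => [|k] km kn kM.
  by rewrite coef0_truncated_exp ?coef_prime_poly0 ?a0.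
apply: (mulfI (_ : k.+1%:R != 0)); first by rewrite pnatr_eq0.
rewrite a_rec coef_truncated_exp_rec; apply: eq_bigr => j _.
have jk := ltn_ord j; rewrite (leq_trans jk kn) /= IH //; lia.
Qed.

(** The first n + 1 coefficients of the exponential truncated at order [n.+1] are exactly a_0, ...,
    a_n; the others are nonnegative, so evaluation at 1 can only add to the sum. *)
Lemma prime_rec_sum_le n : \sum_(0 <= k < n.+1) a k <= expR (prime_recip_sum R n).
Proof.
rewrite -horner_prime_poly1.
apply: le_trans (series_exp_coeff_le_expR n.+1 (horner_prime_poly_ge0 n ler01)).
rewrite -horner_truncated_exp; set E := truncated_exp _ _.
rewrite (horner_coef_wide (n := maxn (size E) n.+1)) ?leq_maxl //.
rewrite -(big_mkord predT (fun i => E`_i * 1 ^+ i)).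
rewrite (big_cat_nat _ (n := n.+1) (p := maxn _ _)) ?leq_maxr //=.
rewrite -[leLHS]addr0; apply: lerD; last first.
  by apply: sumr_ge0 => i _; rewrite expr1n mulr1 coef_truncated_exp_ge0.
rewrite !big_mkord; apply: ler_sum => i _.
by rewrite expr1n mulr1 coef_truncated_exp_eq // -ltnS.
Qed.

(* The coefficients beyond [x^n] are at most [x^n] times their values at
   [x = 1], so primes larger than [n] never enter. *)
Lemma expR_prime_poly_le n x : 0 <= x <= 1 ->
  expR (prime_poly R n).[x] <=
  \sum_(0 <= k < n.+1) a k + x ^+ n * expR (prime_recip_sum R n).
Proof.
move=> /andP[x0 x1].
(* The exponential is the limit of its truncations, so it suffices to bound each of them. *)
apply: limr_le; first exact: is_cvg_series_exp_coeff.
apply: nearW => M /=; rewrite -horner_truncated_exp -horner_prime_poly1.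
apply: le_trans (_ : _ <= \sum_(0 <= k < n.+1) a k +
   x ^+ n * (truncated_exp M (prime_poly R n)).[1]) _; last first.
  rewrite lerD2l ler_wpM2l ?exprn_ge0 // horner_truncated_exp.
  by rewrite series_exp_coeff_le_expR ?horner_prime_poly_ge0.
set E := truncated_exp _ _.
rewrite !(horner_coef_wide (n := maxn (size E) n.+1)) ?leq_maxl //.
rewrite -(big_mkord predT (fun i => E`_i * x ^+ i)).
rewrite -(big_mkord predT (fun i => E`_i * 1 ^+ i)).
rewrite [leLHS](big_cat_nat _ (n := n.+1)) ?leq_maxr //=.
rewrite [X in x ^+ n * X](big_cat_nat _ (n := n.+1)) ?leq_maxr //=.
apply: lerD.
  apply: ler_sum => i _; apply: le_trans (coef_truncated_exp_le n M i).
  by rewrite ler_piMr ?coef_truncated_exp_ge0 // exprn_ile1.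
rewrite mulrDr -[leLHS]add0r; apply: lerD.
  rewrite mulr_ge0 ?exprn_ge0 // sumr_ge0 // => i _.
  by rewrite expr1n mulr1 coef_truncated_exp_ge0.
rewrite mulr_sumr big_nat [leRHS]big_nat; apply: ler_sum => i /andP[ni _].
rewrite expr1n mulr1 mulrC ler_wpM2r ?coef_truncated_exp_ge0 //.
by rewrite ler_wiXn2l // ltnW.
Qed.

End TruncatedExponential.

(** * Chebyshev's bound and Mertens' first theorem *)

Lemma prime_sum_recr (R : realType) (F : nat -> R) (n : nat) :
  \sum_(0 <= p < n.+1 | prime p) F p =
  \sum_(0 <= p < n | prime p) F p + if prime n then F n else 0.
Proof. by rewrite big_mkcond big_nat_recr //= -big_mkcond. Qed.

Lemma prime_sum_lt2 (R : realType) (F : nat -> R) (n : nat) : (n <= 2)%N ->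
  \sum_(0 <= p < n | prime p) F p = 0.
Proof.
move=> n2; rewrite big_nat_cond big1 // => p /andP[/andP[_ pn] /prime_gt1].
by rewrite ltnNge -ltnS (leq_trans pn n2).
Qed.

Lemma ln_inv_pred_le (R : realType) (n : nat) :
  ln (n.+2%:R : R) - ln n.+1%:R <= n.+1%:R^-1.
Proof.
rewrite -ln_div ?posrE ?ltr0n // -natr1 mulrDl mulfV ?pnatr_eq0 // mul1r.
by apply: le_ln1Dx; rewrite (lt_trans (_ : -1 < 0)) ?invr_gt0 ?ltr0n // ltrN10.
Qed.

Lemma inv_le_ln_succ (R : realType) (n : nat) :
  n.+2%:R^-1 <= ln (n.+2%:R : R) - ln n.+1%:R.
Proof.
rewrite -lerN2 opprB -ln_div ?posrE ?ltr0n //.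
have -> : n.+1%:R / n.+2%:R = 1 + - n.+2%:R^-1 :> R.
  rewrite -[n.+2%:R]natr1; have : 0 < n.+1%:R :> R by rewrite ltr0n.
  by move: (n.+1%:R : R) => x x0; field; lra.
apply: le_ln1Dx; rewrite ltrN2 invf_lt1 ?ltr0n //; by rewrite ltr1n.
Qed.

(** Composite indices add nothing on the left and a nonnegative step of [h] on the right. *)
Lemma prime_sum_le_telescope (R : realType) (F h : nat -> R) (N : nat) :
  (forall k, (0 < k)%N -> prime k.+1 -> F k.+1 <= h k - h k.+1) ->
  (forall k, (0 < k)%N -> h k.+1 <= h k) ->
  \sum_(0 <= p < N.+2 | prime p) F p <= h 1%N - h N.+1.
Proof.
move=> Fh hh; elim: N => [|N IH].
  by rewrite prime_sum_lt2 // subrr.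
rewrite prime_sum_recr; case: ifP => pN; last by have := hh N.+1 isT; lra.
by have := Fh N.+1 isT pN; lra.
Qed.

Lemma ln2_gt0 (R : realType) : 0 < ln 2 :> R.
Proof. by rewrite ln_gt0 // ltr1n. Qed.

Lemma ln2_le1 (R : realType) : ln 2 <= 1 :> R.
Proof. by have := @le_ln1Dx R 1 ltac:(lra); rewrite (_ : 1 + 1 = 2). Qed.

Section ChebyshevMertens.
Variable R : realType.
Local Notation lnn n := (ln (n%:R : R)).

Lemma ln_prime_decomp m N : (0 < m)%N ->
  (forall p, prime p -> (p %| m)%N -> (p <= N)%N) ->
  lnn m = \sum_(0 <= p < N.+1 | prime p) (logn p m)%:R * lnn p.
Proof.
move=> m0 mN.
have E : m = (\prod_(0 <= p < (maxn m N).+1 | prime p) p ^ logn p m)%N.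
  rewrite -{1}(partnT m0) (widen_partn _ (leq_maxl m N)) [RHS]big_mkcond /=.
  apply: eq_big => // p _; case: ifP => // /negbT np.
  by rewrite /logn (negbTE np).
have ln_prod (r : seq nat) : lnn (\prod_(p <- r | prime p) p ^ logn p m)%N =
    \sum_(p <- r | prime p) (logn p m)%:R * lnn p.
  suff [] : lnn (\prod_(p <- r | prime p) p ^ logn p m)%N =
     \sum_(p <- r | prime p) (logn p m)%:R * lnn p /\
     (0 < \prod_(p <- r | prime p) p ^ logn p m)%N by [].
  elim/big_rec2: _ => [|p x y /prime_gt0 p0 [<- y0]]; first by rewrite ln1.
  rewrite muln_gt0 y0 expn_gt0 p0 natrM lnM ?posrE ?ltr0n ?expn_gt0 ?p0 //.
  by rewrite natrX lnXn ?ltr0n // mulr_natl.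
rewrite [in LHS]E ln_prod (big_cat_nat _ (n := N.+1)) ?ltnS ?leq_maxr //=.
rewrite [X in _ + X]big_nat_cond [X in _ + X]big1 ?addr0 // => p /andP[/andP[Np _] pp].
suff -> : logn p m = 0%N by rewrite mul0r.
rewrite lognE pp m0 /=; case: ifP => // /(mN _ pp).
by rewrite leqNgt Np.
Qed.

Lemma prime_dvd_fact p n : prime p -> (p %| n`!)%N -> (p <= n)%N.
Proof.
move=> pp; elim: n => [|n IH]; first by rewrite fact0 dvdn1 => /eqP p1; rewrite p1 in pp.
rewrite factS Euclid_dvdM // => /orP[/dvdn_leq -> //|/IH /leq_trans -> //].
Qed.

Lemma lnn_ge0 n : 0 <= lnn n.
Proof. by case: n => [|n]; [rewrite ln0|rewrite ln_ge0 // ler1n]. Qed.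

Lemma ler_lnn m n : (0 < m)%N -> (m <= n)%N -> lnn m <= lnn n.
Proof. by move=> m0 mn; rewrite ler_ln ?posrE ?ltr0n ?ler_nat // (leq_trans m0). Qed.

Lemma lnn_pow2 K : lnn (2 ^ K)%N = K%:R * ln 2.
Proof. by rewrite natrX lnXn ?ltr0n // mulr_natl. Qed.

Lemma bin_leq_pow2 n m : ('C(n, m) <= 2 ^ n)%N.
Proof.
elim: n m => [|n IH] [|m] //; first by rewrite bin0 expn_gt0.
by rewrite binS expnS mul2n -addnn leq_add.
Qed.

(** Every prime in (n, 2n], with n = 2^K, divides the central binomial coefficient C(2n, n), which
    is at most 2^(2n). *)
Lemma chebyshev_dyadic_block K :
  \sum_((2 ^ K).+1 <= p < (2 ^ K.+1).+1 | prime p) lnn p <= 2 ^+ K.+1 * ln 2.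
Proof.
pose n := (2 ^ K)%N; have n2 : (2 ^ K.+1 = n + n)%N by rewrite expnS mul2n addnn.
have C0 : (0 < 'C(n + n, n))%N by rewrite bin_gt0 leq_addr.
have Cf := bin_fact (leq_addr n n); rewrite addnK in Cf.
apply: le_trans (_ : lnn 'C(n + n, n) <= _); last first.
  by rewrite -natrX -lnn_pow2 n2 ler_lnn // bin_leq_pow2.
rewrite (ln_prime_decomp (N := n + n)) //; last first.
  by move=> p pp pC; apply: prime_dvd_fact => //; rewrite -Cf dvdn_mulr.
rewrite n2 [leRHS](big_cat_nat _ (n := n.+1)) ?ltnS ?leq_addr //=.
rewrite -[leLHS]add0r; apply: lerD.
  by apply: sumr_ge0 => p _; rewrite mulr_ge0 ?ler0n ?lnn_ge0.
rewrite big_nat_cond [leRHS]big_nat_cond; apply: ler_sum => p /andP[/andP[np p2n] pp].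
rewrite ler_peMl ?lnn_ge0 // ler1n logn_gt0 mem_primes pp C0 /=.
have : (p %| (n + n)`!)%N by rewrite dvdn_fact // prime_gt0 // -ltnS.
rewrite -Cf !Euclid_dvdM // => /orP[//|/orP[]] /(prime_dvd_fact pp);
  by rewrite leqNgt np.
Qed.

Lemma chebyshev_theta K :
  \sum_(0 <= p < (2 ^ K).+1 | prime p) lnn p <= 2 ^+ K.+1 * ln 2.
Proof.
elim: K => [|K IH].
  by rewrite prime_sum_lt2 // mulr_ge0 // ln_ge0 // ler1n.
rewrite (big_cat_nat _ (n := (2 ^ K).+1)) ?ltnS ?leq_pexp2l //=.
by have := chebyshev_dyadic_block K; rewrite [2 ^+ K.+2]exprS; lra.
Qed.

Lemma ln_fact_le n : lnn n`! <= n%:R * lnn n.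
Proof.
elim: n => [|n IH]; first by rewrite fact0 ln1 mul0r.
rewrite factS natrM lnM ?posrE ?ltr0n ?fact_gt0 // -natr1 mulrDl mul1r addrC.
rewrite lerD2r (le_trans IH) // ler_wpM2l //.
by case: n {IH} => [|n]; [rewrite natr1 ln0 // lnn_ge0|rewrite natr1 ler_lnn].
Qed.

(** n^n/n! is a single term of the series of e^n. *)
Lemma ln_fact_ge n : n%:R * lnn n - n%:R <= lnn n`!.
Proof.
case: n => [|n]; first by rewrite fact0 ln1 mul0r subrr.
have f0 : 0 < (n.+1)`!%:R :> R by rewrite ltr0n fact_gt0.
have H := @expR_ge1Dxn R n.+1%:R n (ler0n _ _).
have {}H : n.+1%:R ^+ n.+1 / n.+1`!%:R <= expR (n.+1%:R : R) by lra.
move: H; rewrite -ler_ln ?posrE ?expR_gt0 ?divr_gt0 ?exprn_gt0 ?ltr0n ?fact_gt0 //.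
rewrite expRK ln_div ?posrE ?exprn_gt0 ?ltr0n ?fact_gt0 // lnXn ?ltr0n // mulr_natl.
by lra.
Qed.

(** Legendre's formula cut after its first term, the floor of n/p. *)
Lemma logn_fact_ge p n : prime p -> n%:R / p%:R - 1 <= (logn p n`!)%:R :> R.
Proof.
move=> pp; have p0 := prime_gt0 pp.
apply: le_trans (_ : (n %/ p)%:R <= _); last first.
  case: n => [|n]; first by rewrite div0n.
  by rewrite ler_nat logn_fact // big_ltn // expn1 leq_addr.
rewrite lerBlDr natr1 ler_pdivrMr ?ltr0n // -natrM ler_nat.
by apply: ltnW; rewrite -ltn_divLR.
Qed.

(** Legendre's formula without the floors is a geometric series; [H] carries its exact partial
    sums. *)
Lemma logn_fact_le p n : prime p -> (logn p n`!)%:R <= n%:R / (p%:R - 1) :> R.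
Proof.
move=> pp; have p1 : 1 < p%:R :> R by rewrite ltr1n prime_gt1.
have p0 : 0 < p%:R :> R by lra.
have pn0 k : p%:R ^+ k != 0 :> R by rewrite expf_neq0 // gt_eqF.
rewrite logn_fact //.
have H N : (\sum_(1 <= k < N.+1) n %/ p ^ k)%N%:R <=
     n%:R / (p%:R - 1) * (1 - p%:R ^- N) :> R.
  elim: N => [|N IH]; first by rewrite big_nil expr0 invr1 subrr mulr0.
  rewrite big_nat_recr //= natrD.
  have : (n %/ p ^ N.+1)%:R <= n%:R / p%:R ^+ N.+1 :> R.
    by rewrite ler_pdivlMr ?exprn_gt0 // -natrX -natrM ler_nat leq_trunc_div.
  have -> : n%:R / (p%:R - 1) * (1 - p%:R ^- N.+1) =
    n%:R / (p%:R - 1) * (1 - p%:R ^- N) + n%:R / p%:R ^+ N.+1 :> R.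
    rewrite exprS; field; rewrite pn0 /=; apply/andP; split; lra.
  by lra.
apply: le_trans (H n) _; rewrite ler_piMr //.
  by rewrite divr_ge0 // subr_ge0 ltW.
Qed.

Definition mertens_log_sum (N : nat) : R :=
  \sum_(0 <= p < N.+1 | prime p) lnn p / p%:R.

Lemma sum_ln_div_ppred_le N :
  \sum_(0 <= p < N.+1 | prime p) lnn p / (p%:R * (p%:R - 1)) <= 2.
Proof.
case: N => [|N]; first by rewrite prime_sum_lt2.
(* The function (ln t + 1)/t is an antiderivative of -(ln t)/t^2. Raising the 1 to 2 absorbs the
   discretization, and [h 1 = 2] is the final bound. *)
pose h n : R := (lnn n + 2) / n%:R.
have hpos n : 0 <= h n by rewrite divr_ge0 ?addr_ge0 ?lnn_ge0.
have dh k : (0 < k)%N -> lnn k.+1 / (k.+1%:R * (k.+1%:R - 1)) <= h k - h k.+1.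
  case: k => // k _; have := ln_inv_pred_le R k.
  set a := lnn k.+2; set b := lnn k.+1.
  have -> : k.+2%:R = k.+1%:R + 1 :> R by rewrite natr1.
  set x : R := k.+1%:R; have x1 : 1 <= x by rewrite ler1n.
  move=> H; rewrite -subr_ge0.
  have -> : h k.+1 - h k.+2 - a / ((x + 1) * (x + 1 - 1)) =
     ((x + 1) * (b - a) + 2) / (x * (x + 1)).
    rewrite /h -/a -/b; have -> : k.+2%:R = x + 1 by rewrite natr1.
    by field; apply/andP; split; lra.
  clearbody a b x; rewrite divr_ge0 //; last by nra.
  have : (x + 1) * (a - b) <= (x + 1) * x^-1 by rewrite ler_wpM2l //; lra.
  have : x^-1 <= 1 by rewrite invf_le1 //; lra.
  rewrite [(x + 1) * x^-1]mulrDl mulfV; last by lra.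
  lra.
apply: le_trans (_ : h 1%N - h N.+1 <= _); last first.
  have -> : h 1%N = 2 by rewrite /h ln1 add0r divr1.
  by rewrite lerBlDr lerDl.
apply: prime_sum_le_telescope => k k0; first by move=> _; exact: dh.
rewrite -subr_ge0; apply: le_trans (dh k k0).
by rewrite divr_ge0 ?lnn_ge0 // mulr_ge0 // subr_ge0 ler1n.
Qed.

(** Two evaluations of ln N! at N = 2^K are compared. By Legendre it lies between N B - theta(N) and
    N B + 2 N, with B the sum of (ln p)/p and theta(N) <= 2 N ln 2; directly, it lies between N ln N
    - N and N ln N. The constant 3 is 2 + 1. *)
Lemma mertens_first K :
  `|mertens_log_sum (2 ^ K) - K%:R * ln 2| <= 3.
Proof.
pose N := (2 ^ K)%N; have N0 : 0 < N%:R :> R by rewrite ltr0n expn_gt0.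
have lnN : lnn N = K%:R * ln 2 by exact: lnn_pow2.
have E : lnn N`! = \sum_(0 <= p < N.+1 | prime p) (logn p N`!)%:R * lnn p.
  by apply: ln_prime_decomp; [exact: fact_gt0|move=> p; exact: prime_dvd_fact].
have ln2 := ln2_le1 R.
have U : N%:R * mertens_log_sum N - 2 ^+ K.+1 * ln 2 <= lnn N`!.
  apply: le_trans (_ : N%:R * mertens_log_sum N -
     \sum_(0 <= p < N.+1 | prime p) lnn p <= _).
    by have := chebyshev_theta K; rewrite -/N; lra.
  rewrite E /mertens_log_sum mulr_sumr -sumrB; apply: ler_sum => p pp.
  have := ler_wpM2r (lnn_ge0 p) (logn_fact_ge N pp).
  by rewrite mulrBl mul1r mulrAC mulrA.
have L : lnn N`! <= N%:R * mertens_log_sum N + N%:R * 2.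
  apply: le_trans (_ : _ <= N%:R * mertens_log_sum N + N%:R *
     \sum_(0 <= p < N.+1 | prime p) lnn p / (p%:R * (p%:R - 1))) _; last first.
    by rewrite lerD2l ler_wpM2l ?sum_ln_div_ppred_le.
  rewrite E /mertens_log_sum !mulr_sumr -big_split /=; apply: ler_sum => p pp.
  have p1 : 1 < p%:R :> R by rewrite ltr1n prime_gt1.
  have := ler_wpM2r (lnn_ge0 p) (logn_fact_le N pp).
  have -> : N%:R / (p%:R - 1) * lnn p = N%:R * (lnn p / p%:R) +
    N%:R * (lnn p / (p%:R * (p%:R - 1))) :> R by field; apply/andP; split; lra.
  by [].
have := ln_fact_le N; have := ln_fact_ge N; rewrite -/N lnN.
have e2 : 2 ^+ K.+1 = 2 * N%:R :> R by rewrite exprS natrX.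
rewrite e2 in U; set B := mertens_log_sum _ in U L *; set t := K%:R * ln 2.
move=> H1 H2.
have B1 : N%:R * (B - t) <= N%:R * 3 by nra.
have B2 : N%:R * (t - B) <= N%:R * 3 by nra.
rewrite !ler_pM2l // in B1 B2.
by rewrite ler_norml; apply/andP; split; lra.
Qed.

End ChebyshevMertens.

(** * Mertens' second theorem along powers of two *)

Section DyadicMertens.
Variable R : realType.
Local Notation lnn n := (ln (n%:R : R)).

Definition dyadic_sum (F : nat -> R) (k : nat) : R :=
  \sum_((2 ^ k).+1 <= p < (2 ^ k.+1).+1 | prime p) F p.

Lemma prime_sum_dyadic (F : nat -> R) K :
  \sum_(0 <= p < (2 ^ K).+1 | prime p) F p = \sum_(0 <= k < K) dyadic_sum F k.
Proof.
elim: K => [|K IH]; first by rewrite prime_sum_lt2 // big_geq.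
rewrite big_nat_recr //= -IH (big_cat_nat _ (n := (2 ^ K).+1)) //=.
by rewrite ltnS leq_pexp2l.
Qed.

Lemma ler_dyadic_sum (F G : nat -> R) k :
  (forall p, prime p -> (2 ^ k < p)%N -> (p <= 2 ^ k.+1)%N -> F p <= G p) ->
  dyadic_sum F k <= dyadic_sum G k.
Proof.
move=> FG; rewrite /dyadic_sum big_nat_cond [leRHS]big_nat_cond.
by apply: ler_sum => p /andP[/andP[kp pk] pp]; apply: FG.
Qed.

Definition dyadic_recip (k : nat) : R := dyadic_sum (fun p => p%:R^-1) k.
Definition dyadic_log (k : nat) : R := dyadic_sum (fun p => lnn p / p%:R) k.

(** For primes in the k-th dyadic block, log_2 p lies in (k, k + 1], so [w k] approximates 1/log_2 p
    there. [r] is the error in Mertens' first theorem, in units of ln 2. *)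
Let w (k : nat) : R := k.+1%:R^-1.
Let r (K : nat) : R := mertens_log_sum R (2 ^ K) / ln 2 - K%:R.

Let ln2_gt0 := ln2_gt0 R.

Lemma dyadic_logE k :
  dyadic_log k = mertens_log_sum R (2 ^ k.+1) - mertens_log_sum R (2 ^ k).
Proof.
by rewrite /mertens_log_sum !prime_sum_dyadic big_nat_recr //= addrAC subrr add0r.
Qed.

(** 7 = 3 + 3 + 1: two uses of [mertens_first], and ln 2 <= 1. *)
Lemma dyadic_log_le k : dyadic_log k <= 7.
Proof.
have := mertens_first R k; have := mertens_first R k.+1.
have := ln2_le1 R.
rewrite dyadic_logE !ler_norml -[k.+1%:R]natr1 mulrDl => ? /andP[_ ?] /andP[? _].
lra.
Qed.

Lemma dyadic_recip_le k : dyadic_recip k <= 14 / ln 2 * w k.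
Proof.
apply: le_trans (_ : 2 / ln 2 * w k * dyadic_log k <= _); last first.
  rewrite [14 / ln 2 * w k](_ : _ = 2 / ln 2 * w k * 7); last by ring.
  rewrite ler_wpM2l ?dyadic_log_le // mulr_ge0 ?divr_ge0 ?invr_ge0 // ltW //.
rewrite /dyadic_log /dyadic_recip /dyadic_sum mulr_sumr; apply: ler_dyadic_sum.
move=> p pp kp _.
have p0 : 0 < p%:R :> R by rewrite ltr0n prime_gt0.
have k0 : 0 < k.+1%:R :> R by rewrite ltr0n.
(* Both ln 2 and k ln 2 are at most ln p; the first one covers the block k = 0. *)
have H : k.+1%:R * ln 2 <= 2 * lnn p.
  have H1 : ln 2 <= lnn p by rewrite (ler_lnn R (m := 2)) // prime_gt1.
  have H2 : k%:R * ln 2 <= lnn p by rewrite -lnn_pow2 ler_lnn ?expn_gt0 // ltnW.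
  by rewrite -natr1; lra.
have -> : 2 / ln 2 * w k * (lnn p / p%:R) = (2 * lnn p) / (k.+1%:R * ln 2) / p%:R.
  by rewrite /w invfM; ring.
rewrite -[leLHS]mul1r ler_wpM2r ?invr_ge0 ?(ltW p0) //.
by rewrite ler_pdivlMr ?mul1r // mulr_gt0.
Qed.

(** On the block, ln p / ((k + 1) ln 2) lies between 1 - [w k] and 1. Together with
    [dyadic_recip_le], this makes the error O(1/k^2), hence summable. *)
Lemma dyadic_recip_log k :
  0 <= dyadic_recip k - dyadic_log k / ln 2 * w k <= dyadic_recip k * w k.
Proof.
have k0 : 0 < k.+1%:R :> R by rewrite ltr0n.
have E : dyadic_recip k - dyadic_log k / ln 2 * w k =
   dyadic_sum (fun p => p%:R^-1 * (1 - lnn p / (k.+1%:R * ln 2))) k.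
  rewrite /dyadic_log /dyadic_recip /dyadic_sum !mulr_suml -sumrB.
  by apply: eq_bigr => p _; rewrite /w invfM; ring.
have B p : prime p -> (2 ^ k < p)%N -> (p <= 2 ^ k.+1)%N ->
    0 <= 1 - lnn p / (k.+1%:R * ln 2) <= w k.
  move=> pp kp pk.
  have H1 : lnn p <= k.+1%:R * ln 2 by rewrite -lnn_pow2 ler_lnn ?prime_gt0.
  have H2 : k%:R * ln 2 <= lnn p by rewrite -lnn_pow2 ler_lnn ?expn_gt0 // ltnW.
  have kl : 0 < k.+1%:R * ln 2 :> R by rewrite mulr_gt0.
  rewrite subr_ge0 ler_pdivrMr // mul1r H1 /=.
  rewrite lerBlDl -lerBlDr ler_pdivlMr // mulrBl mul1r.
  have -> : w k * (k.+1%:R * ln 2) = ln 2 by rewrite mulrA mulVf ?mul1r ?gt_eqF.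
  by rewrite -natr1 mulrDl mul1r addrK.
rewrite E; apply/andP; split.
  rewrite [leLHS](_ : 0 = dyadic_sum (fun => 0) k); last by rewrite /dyadic_sum big1.
  apply: ler_dyadic_sum => p pp kp pk; rewrite mulr_ge0 ?invr_ge0 //.
  by case/andP: (B p pp kp pk).
rewrite /dyadic_recip /dyadic_sum mulr_suml; apply: ler_dyadic_sum => p pp kp pk.
by rewrite ler_wpM2l ?invr_ge0 //; case/andP: (B p pp kp pk).
Qed.

Lemma inv_succ_diff k : w k - w k.+1 = w k * w k.+1.
Proof.
rewrite /w; have -> : k.+2%:R = k.+1%:R + 1 :> R by rewrite natr1.
have : 0 < k.+1%:R :> R by rewrite ltr0n.
by move: (k.+1%:R : R) => x x0; field; apply/andP; split; lra.
Qed.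

Lemma inv_succ_gt0 k : 0 < w k. Proof. by rewrite invr_gt0 ltr0n. Qed.

Lemma inv_succ_sqr_le k : w k * w k <= 2 * (w k - w k.+1).
Proof.
rewrite inv_succ_diff mulrCA ler_pM2l ?inv_succ_gt0 // /w -ler_pdivrMl // -invfM.
by rewrite lef_pV2 ?posrE ?mulr_gt0 ?ltr0n // -natrM ler_nat mul2n -addnn; lia.
Qed.

Lemma cvg_series_telescope_bound (u : nat -> R) C :
  (forall k, `|u k| <= C * (w k - w k.+1)) -> cvgn (series u).
Proof.
move=> uC.
have C0 k : 0 <= C * (w k - w k.+1) by apply: le_trans (uC k).
apply: normed_cvg.
apply: (@series_le_cvg R _ (fun k => C * (w k - w k.+1))) => [k|k|k|] /=;
  [exact: normr_ge0|exact: C0|exact: uC|].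
have -> : series (fun k => C * (w k - w k.+1)) = (fun n => C * (1 - w n)).
  apply/funext => n; rewrite /series /= -mulr_sumr; congr (C * _).
  rewrite -[RHS]opprB -(invr1 R) -(telescope_sumr w (leq0n n)) -sumrN.
  by apply: eq_bigr => k _; rewrite opprB.
apply/cvg_ex; exists (C * (1 - 0)); apply: cvgM; first exact: cvg_cst.
by apply: cvgB; [exact: cvg_cst|exact: cvg_harmonic].
Qed.

(** Partial summation: [dyadic_log K / ln 2] equals 1 + r(K+1) - r(K). The 1's build the harmonic
    sum, and moving the differences of [r] onto [w] leaves a boundary term and an absolutely
    convergent series. *)
Lemma dyadic_recip_sum_abel K :
  prime_recip_sum R (2 ^ K) - series harmonic K =
  r K * w K + series (fun k => dyadic_recip k - dyadic_log k / ln 2 * w k +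
                               r k.+1 * (w k - w k.+1)) K.
Proof.
rewrite /prime_recip_sum prime_sum_dyadic; elim: K => [|K IH].
  have -> : r 0 = 0 by rewrite /r /mertens_log_sum prime_sum_lt2 // mul0r subrr.
  by rewrite !seriesEnat /= !big_geq // subr0 mul0r addr0.
rewrite big_nat_recr //= !seriesSr.
have -> : dyadic_log K / ln 2 = r K.+1 - r K + 1.
  by rewrite dyadic_logE /r -[K.+1%:R]natr1; ring.
have -> : dyadic_sum (fun p => p%:R^-1) K = dyadic_recip K by [].
have -> : harmonic K = w K :> R by [].
move: IH; set s := series _ K; set t := series _ K; set q := \sum_(_ <= _ < _) _.
move: (s) (t) (q) => s' t' q' IH.
have -> : q' = r K * w K + t' + s' by rewrite -IH subrK.
by ring.
Qed.

Lemma mertens_remainder_le K : `|r K| <= 3 / ln 2.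
Proof.
rewrite /r; have -> : mertens_log_sum R (2 ^ K) / ln 2 - K%:R =
  (mertens_log_sum R (2 ^ K) - K%:R * ln 2) / ln 2 by field; rewrite gt_eqF.
rewrite normrM normfV (ger0_norm (ltW ln2_gt0)).
by rewrite ler_wpM2r ?invr_ge0 ?mertens_first // ltW.
Qed.

Lemma is_cvg_dyadic_recip_sum :
  cvgn (fun K => prime_recip_sum R (2 ^ K) - series harmonic K).
Proof.
have -> : (fun K => prime_recip_sum R (2 ^ K) - series harmonic K) =
  (fun K => r K * w K + series (fun k => dyadic_recip k -
     dyadic_log k / ln 2 * w k + r k.+1 * (w k - w k.+1)) K).
  by apply/funext => K; exact: dyadic_recip_sum_abel.
apply: is_cvgD.
  apply/cvg_ex; exists 0; apply/cvgr0Pnorm_le => e e0.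
  have c0 : 0 < 3 / ln 2 :> R by rewrite divr_gt0.
  have e1 : 0 < e / (3 / ln 2) by rewrite divr_gt0.
  have /cvgr0Pnorm_le/(_ _ e1) := @cvg_harmonic R.
  apply: filterS => K; rewrite /harmonic /= -/(w K) ler_pdivlMr // => H.
  by rewrite normrM mulrC; apply: le_trans H; rewrite ler_wpM2l ?mertens_remainder_le.
(* 28 = 14 * 2 comes from [dyadic_recip_le] and [inv_succ_sqr_le]; 3 comes from
   [mertens_remainder_le]. *)
apply: (cvg_series_telescope_bound (C := 28 / ln 2 + 3 / ln 2)) => k.
rewrite [leRHS]mulrDl; apply: le_trans (ler_normD _ _) _; apply: lerD.
  case/andP: (dyadic_recip_log k) => H1 H2; rewrite ger0_norm //.
  apply: le_trans H2 _.
  apply: le_trans (ler_wpM2r (ltW (inv_succ_gt0 k)) (dyadic_recip_le k)) _.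
  have -> : 28 / ln 2 = 14 / ln 2 * 2 :> R by ring.
  have : 0 <= 14 / ln 2 :> R by rewrite divr_ge0 // ltW.
  by move: (14 / ln 2 : R) => c c0; rewrite -!mulrA ler_wpM2l ?inv_succ_sqr_le.
have H : 0 <= w k - w k.+1 by rewrite inv_succ_diff mulr_ge0 // ltW // inv_succ_gt0.
by rewrite normrM (ger0_norm H) ler_wpM2r ?mertens_remainder_le.
Qed.

End DyadicMertens.

(** * Abel's theorem, the logarithm series and Euler's constant *)

(** Abel's theorem stated on finite sums: [eta] depends on [e] but not on [x], and [K] is large once
    [x] is given. It can then be combined with other estimates at one fixed [x] and [K]. *)
Lemma abel_summation_eps (R : realType) (D : nat -> R) (L e : R) :
  D 0%N = 0 -> D @ \oo --> L -> 0 < e ->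
  exists2 eta, 0 < eta & forall x, 0 < x -> 1 - eta < x -> x < 1 ->
    \forall K \near \oo,
      `|\sum_(0 <= k < K) (D k.+1 - D k) * x ^+ k.+1 - L| <= e.
Proof.
move=> D0 DL e0.
have e3 : 0 < e / 3 by lra.
have /cvgrPdist_le/(_ _ e3)[k0 _ Dk0] := DL.
pose M := \sum_(0 <= k < k0) `|D k - L|.
have M0 : 0 <= M by apply: sumr_ge0.
exists (e / 3 / (M + 1)); first by rewrite divr_gt0 //; lra.
move=> x x0; rewrite ltrBlDr -ltrBlDl ltr_pdivlMr; last by lra.
move=> xM x1; exists k0 => // K /= k0K.
(* Summation by parts, using [D 0 = 0]. The factor 1 - x damps the first [k0] deviations, whose
   total is at most [M]; the later ones are at most e/3 and meet a geometric sum. *)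
have -> : \sum_(0 <= k < K) (D k.+1 - D k) * x ^+ k.+1 - L =
    (D K - L) * x ^+ K + (1 - x) * \sum_(0 <= k < K) (D k - L) * x ^+ k.
  elim: K {k0K} => [|K IH]; first by rewrite !big_geq // D0; ring.
  rewrite !big_nat_recr //= mulrDr addrA.
  set s := \sum_(_ <= _ < _) _ in IH *; set t := \sum_(_ <= _ < _) _ in IH *.
  have -> : s = (D K - L) * x ^+ K + (1 - x) * t + L by rewrite -IH subrK.
  by rewrite exprS; ring.
have geo : (1 - x) * \sum_(0 <= k < K) x ^+ k <= 1.
  rewrite big_mkord -opprB mulNr -subrX1 opprB.
  by rewrite lerBlDr lerDl exprn_ge0 // ltW.
have xk k : 0 <= x ^+ k <= 1 by rewrite exprn_ge0 ?exprn_ile1 // ltW.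
have T1 : `|(D K - L) * x ^+ K| <= e / 3.
  rewrite normrM distrC (ger0_norm (_ : 0 <= x ^+ K)); last by case/andP: (xk K).
  rewrite -[leRHS]mulr1; apply: ler_pM => //; first by case/andP: (xk K).
    exact: Dk0.
  by case/andP: (xk K).
have T2 : `|\sum_(0 <= k < K) (D k - L) * x ^+ k| <=
    M + e / 3 * \sum_(0 <= k < K) x ^+ k.
  apply: le_trans (ler_norm_sum _ _ _) _.
  apply: le_trans (_ : _ <= \sum_(0 <= k < K)
     ((if (k < k0)%N then `|D k - L| else 0) + e / 3 * x ^+ k)) _.
    apply: ler_sum => k _; case/andP: (xk k) => xk0 xk1.
    rewrite normrM (ger0_norm xk0); case: ltnP => kk.
      rewrite -[leLHS]addr0; apply: lerD; last by rewrite mulr_ge0 // ltW.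
      by rewrite ler_piMr.
    by rewrite add0r ler_wpM2r // distrC Dk0.
  rewrite big_split /= -mulr_sumr lerD2r (big_cat_nat _ (n := k0)) //=.
  rewrite [X in _ + X <= _]big_nat [X in _ + X <= _]big1 ?addr0; last first.
    by move=> k /andP[kk _]; rewrite ltnNge kk.
  by rewrite /M big_nat [leRHS]big_nat; apply: ler_sum => k /andP[_ ->].
apply: le_trans (ler_normD _ _) _.
rewrite [`|(1 - x) * _|]normrM (ger0_norm (_ : 0 <= 1 - x)); last by lra.
have : (1 - x) * `|\sum_(0 <= k < K) (D k - L) * x ^+ k| <=
   (1 - x) * (M + e / 3 * \sum_(0 <= k < K) x ^+ k).
  by rewrite ler_wpM2l //; lra.
rewrite mulrDr mulrCA.
have : e / 3 * ((1 - x) * \sum_(0 <= k < K) x ^+ k) <= e / 3 * 1.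
  by rewrite ler_wpM2l // ltW.
have : (1 - x) * M <= e / 3 by nra.
lra.
Qed.

(** The remainder vanishes at 0 and has derivative t^K/(1 - t), by the geometric sum; the mean value
    theorem does the rest. *)
Lemma ln_series_remainder (R : realType) (x : R) K : 0 <= x < 1 ->
  0 <= - ln (1 - x) - \sum_(0 <= k < K) x ^+ k.+1 / k.+1%:R <= x ^+ K / (1 - x).
Proof.
move=> /andP[x0 x1].
pose f (t : R) := - ln (1 - t) - \sum_(0 <= k < K) t ^+ k.+1 / k.+1%:R.
pose df (t : R) := (1 - t)^-1 - \sum_(k < K) t ^+ k.
have fd (t : R) : t < 1 -> is_derive t 1 f (df t).
  move=> t1.
  have D1 : is_derive t 1 (fun t : R => ln (1 - t)) (- (1 - t)^-1).
    have Dl : is_derive (1 - t) 1 (@ln R) (1 - t)^-1.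
      by apply: is_derive1_ln; lra.
    have D2 : is_derive t 1 (fun t : R => 1 - t) (-1).
      by apply: is_derive_eq; rewrite add0r mul1r.
    have := @is_derive1_comp R (@ln R) (fun t => 1 - t) t _ _ Dl D2.
    by rewrite mulrN1.
  have D3 : is_derive t 1 (fun t : R => \sum_(0 <= k < K) t ^+ k.+1 / k.+1%:R)
      (\sum_(k < K) t ^+ k).
    have -> : (fun t : R => \sum_(0 <= k < K) t ^+ k.+1 / k.+1%:R) =
       \sum_(k < K) (fun t : R => t ^+ k.+1 / k.+1%:R).
      by apply/funext => u; rewrite fct_sumE big_mkord.
    apply: is_derive_sum => k.
    have -> : (fun t : R => t ^+ k.+1 / k.+1%:R) = k.+1%:R^-1 \*: (@id R ^+ k.+1).
      by apply/funext => u; rewrite mulrC /= exprfctE.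
    apply: is_derive_eq; rewrite /GRing.scale /=.
    by rewrite mulr1 mulrA mulVf ?mul1r // pnatr_eq0.
  by apply: is_derive_eq; rewrite opprK.
have f0 : f 0 = 0.
  rewrite /f subr0 ln1 oppr0 big1 ?subr0 // => k _.
  by rewrite expr0n mul0r.
have dfE (t : R) : t < 1 -> df t = t ^+ K / (1 - t).
  move=> t1; rewrite /df; apply: (mulfI (_ : 1 - t != 0)); first by lra.
  rewrite mulrBr mulfV; last by lra.
  rewrite -(opprB t 1) mulNr -subrX1 mulrCA mulfV; last by lra.
  by ring.
have [||c] := @MVT_segment R f df 0 x x0.
- by move=> t; rewrite in_itv /= => /andP[_ tx]; apply: fd; lra.
- apply: derivable_within_continuous => t; rewrite in_itv /= => /andP[_ tx].
  by have [] := fd t ltac:(lra).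
rewrite in_itv /= f0 !subr0 => /andP[c0 cx].
rewrite dfE; last by lra.
rewrite /f => ->.
have cK : 0 <= c ^+ K <= x ^+ K.
  by rewrite exprn_ge0 //=; apply: lerXn2r; rewrite ?nnegrE.
case/andP: cK => cK0 cK1.
rewrite mulr_ge0 ?divr_ge0 //=; last by lra.
rewrite -[leRHS]mulr1; apply: ler_pM; rewrite ?divr_ge0 //; [lra| |lra].
apply: ler_pM => //; first by rewrite invr_ge0; lra.
by rewrite lef_pV2 ?posrE; lra.
Qed.

Lemma is_cvg_euler_gamma (R : realType) :
  cvgn (fun n : nat => series harmonic n - ln (n%:R : R)).
Proof.
have lnH n : ln (n.+1%:R : R) <= series harmonic n.
  elim: n => [|n IH]; first by rewrite ln1 seriesEnat /= big_geq.
  rewrite seriesSr -(subrK (ln n.+1%:R) (ln n.+2%:R)) [leRHS]addrC; apply: lerD => //.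
  exact: ln_inv_pred_le.
apply/cvg_ex.
(* At index 0, where [ln 0 = 0], the sequence is 0 and then rises to 1, so monotonicity starts only
   at index 1. *)
have /cvg_ex[l ul] : cvgn (fun n : nat => series harmonic n.+1 - ln (n.+1%:R : R)).
  apply: nonincreasing_is_cvgn.
    apply/nonincreasing_seqP => n; rewrite (seriesSr _ n.+1) -addrA lerD2l.
    by rewrite lerBlDr addrC; exact: inv_le_ln_succ.
  exists 0 => _ [n _ <-]; rewrite subr_ge0; apply: le_trans (lnH n.+1).
  by rewrite ler_ln ?posrE ?ltr0n // ler_nat.
by exists l; move: ul; rewrite (cvg_shiftS (fun n => series harmonic n - ln (n%:R : R))).
Qed.

(** * The Euler product by sieving *)

Lemma cvg_divn_infty (y : nat) : (0 < y)%N -> (N %/ y)%N @[N --> \oo] --> \oo.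
Proof.
move=> y0 A [k _ kA]; exists (k * y)%N => // N /= kN.
by apply: kA => /=; rewrite leq_divRL.
Qed.

Lemma sum_multiples (R : realType) (h : nat -> R) (y N : nat) : (0 < y)%N ->
  \sum_(1 <= n < N.+1 | (y %| n)%N) h n = \sum_(1 <= m < (N %/ y).+1) h (y * m)%N.
Proof.
move=> y0; elim: N => [|N IH]; first by rewrite div0n !big_geq.
rewrite big_mkcond big_nat_recr //= -big_mkcond IH divnS //.
case: ifP => yN; last by rewrite addr0.
rewrite add1n [RHS]big_nat_recr //=; congr (_ + h _).
by rewrite mulnC -(divnK yN) divnS // yN.
Qed.

Definition rough (y n : nat) : bool :=
  all (fun q => prime q ==> ~~ (q %| n)%N) (iota 0 y).

Lemma roughP y n :
  reflect (forall q, prime q -> (q < y)%N -> ~~ (q %| n)%N) (rough y n).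
Proof.
apply: (iffP allP) => [H q pq qy|H q].
  by move: (H q); rewrite mem_iota pq => /(_ qy).
by rewrite mem_iota /= add0n => qy; apply/implyP => pq; apply: H.
Qed.

Lemma rough_succ y n : rough y.+1 n = rough y n && (prime y ==> ~~ (y %| n)%N).
Proof. by rewrite /rough -addn1 iotaD all_cat /= add0n andbT. Qed.

Lemma rough_mul y m : prime y -> rough y (y * m) = rough y m.
Proof.
move=> py.
have E q : prime q -> (q < y)%N -> (q %| y * m)%N = (q %| m)%N.
  by move=> pq qy; rewrite Euclid_dvdM // dvdn_prime2 // ltn_eqF.
by apply/roughP/roughP => H q pq qy; have := H q pq qy; rewrite E.
Qed.

Section EulerSieve.
Variables (R : realType) (d : R).
Hypothesis d0 : 0 < d.
Local Notation lnn n := (ln (n%:R : R)).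

(** For n >= 1, [npow n] is n^(-d) and [zeta_term n] is n^(-1-d). At 0 both equal 1, since
    [ln 0 = 0]; the sums below start at 1 or run over primes. *)
Definition npow (n : nat) : R := expR (- d * lnn n).
Definition zeta_term (n : nat) : R := expR (- (1 + d) * lnn n).

Lemma zeta_termE n : (0 < n)%N -> zeta_term n = n%:R^-1 * npow n.
Proof.
move=> n0; rewrite /zeta_term /npow opprD mulrDl expRD mulN1r expRN lnK //.
by rewrite posrE ltr0n.
Qed.

Lemma zeta_termM m n : (0 < m)%N -> (0 < n)%N ->
  zeta_term (m * n) = zeta_term m * zeta_term n.
Proof.
by move=> m0 n0; rewrite /zeta_term natrM lnM ?posrE ?ltr0n // mulrDr expRD.
Qed.

Lemma npow_ge0 n : 0 <= npow n. Proof. exact: expR_ge0. Qed.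
Lemma zeta_term_ge0 n : 0 <= zeta_term n. Proof. exact: expR_ge0. Qed.

Lemma npow1 : npow 1 = 1. Proof. by rewrite /npow ln1 mulr0 expR0. Qed.
Lemma zeta_term1 : zeta_term 1 = 1. Proof. by rewrite /zeta_term ln1 mulr0 expR0. Qed.

Lemma npow_pow2 K : npow (2 ^ K) = npow 2 ^+ K.
Proof. by rewrite /npow lnn_pow2 -expRM_natl mulrCA. Qed.

Lemma npow2_lt1 : npow 2 < 1.
Proof. by rewrite expR_lt1 mulNr oppr_lt0 mulr_gt0 // ln_gt0 // ltr1n. Qed.

Lemma cvg_npow2 : npow 2 ^+ K @[K --> \oo] --> 0.
Proof. by apply: cvg_expr; rewrite ger0_norm ?npow_ge0 // npow2_lt1. Qed.

(** A discrete form of (t^(-d))' = -d t^(-1-d), obtained from e^u >= 1 + u. With [diff_le_zeta_term]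
    it replaces comparison with an integral. *)
Lemma zeta_term_le_diff n : d * zeta_term n.+2 <= npow n.+1 - npow n.+2.
Proof.
rewrite zeta_termE // lerBrDr.
have -> : npow n.+1 = npow n.+2 * expR (d * (lnn n.+2 - lnn n.+1)).
  by rewrite /npow -expRD; congr expR; ring.
rewrite mulrA -[X in _ + X]mul1r -mulrDl [leRHS]mulrC ler_wpM2r ?npow_ge0 //.
apply: le_trans (expR_ge1Dx _); rewrite addrC lerD2l ler_wpM2l ?(ltW d0) //.
exact: inv_le_ln_succ.
Qed.

Lemma diff_le_zeta_term n : npow n.+1 - npow n.+2 <= d * zeta_term n.+1.
Proof.
rewrite zeta_termE //.
have -> : npow n.+2 = npow n.+1 * expR (- d * (lnn n.+2 - lnn n.+1)).
  by rewrite /npow -expRD; congr expR; ring.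
rewrite mulrA [_ * npow _]mulrC -{1}[npow n.+1]mulr1 -mulrBr.
rewrite ler_wpM2l ?npow_ge0 // lerBlDr -lerBlDl.
apply: le_trans (expR_ge1Dx _); rewrite mulNr lerD2l lerN2.
by rewrite ler_wpM2l ?(ltW d0) //; exact: ln_inv_pred_le.
Qed.

Definition rough_zeta (y N : nat) : R :=
  \sum_(1 <= n < N.+1 | rough y n) zeta_term n.

Lemma rough_zetaS y N : rough_zeta y N.+1 =
  rough_zeta y N + if rough y N.+1 then zeta_term N.+1 else 0.
Proof. by rewrite /rough_zeta big_mkcond big_nat_recr // -big_mkcond. Qed.

(** One step of the sieve: the rough multiples of [y] up to [N] are [y * m] with [m] rough and at
    most [N %/ y], and [zeta_term] is multiplicative. *)
Lemma rough_zeta_prime y N : prime y ->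
  rough_zeta y.+1 N = rough_zeta y N - zeta_term y * rough_zeta y (N %/ y).
Proof.
move=> py; have y0 := prime_gt0 py.
rewrite /rough_zeta [X in _ = X - _](bigID (fun n => (y %| n)%N)) /=.
have -> : \sum_(1 <= n < N.+1 | rough y n && (y %| n)%N) zeta_term n =
    zeta_term y * \sum_(1 <= n < (N %/ y).+1 | rough y n) zeta_term n.
  rewrite big_mkcondl /= sum_multiples // mulr_sumr [RHS]big_mkcond /=.
  rewrite big_nat [RHS]big_nat; apply: eq_bigr => m /andP[m0 _].
  by rewrite rough_mul //; case: ifP => // _; rewrite zeta_termM.
rewrite addrAC subrr add0r; apply: eq_bigl => n.
by rewrite rough_succ py.
Qed.

Lemma rough_zeta_nonprime y N : ~~ prime y -> rough_zeta y.+1 N = rough_zeta y N.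
Proof.
move=> py; apply: eq_bigl => n.
by rewrite rough_succ (negbTE py) andbT.
Qed.

Lemma rough_zeta_ge1 y N : (0 < N)%N -> 1 <= rough_zeta y N.
Proof.
case: N => // N _; rewrite /rough_zeta big_ltn_cond //.
have -> : rough y 1.
  by apply/roughP => q pq _; rewrite dvdn1; apply: contraTneq pq => ->.
by rewrite zeta_term1 lerDl; apply: sumr_ge0 => n _; exact: zeta_term_ge0.
Qed.

(** An n with 1 < n <= y + 1 has a prime factor below y + 2, so only n = 1 can survive. *)
Lemma rough_zeta_small y : rough_zeta y.+2 y.+1 <= 1.
Proof.
rewrite /rough_zeta big_ltn_cond // big_nat_cond big1 ?addr0.
  by case: ifP => // _; rewrite zeta_term1.
move=> n /andP[/andP[n1 ny] /roughP/(_ (pdiv n) (pdiv_prime n1))].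
by rewrite pdiv_dvd /= => /(_ (leq_ltn_trans (pdiv_leq (ltnW n1)) ny)).
Qed.

(** Past y + 1 roughness is forgotten and the whole tail telescopes by [zeta_term_le_diff]. *)
Lemma rough_zeta_le y N : rough_zeta y.+2 N <= 1 + npow y.+1 / d.
Proof.
have step k : rough_zeta y.+2 (y.+1 + k) <= 1 + (npow y.+1 - npow (y.+1 + k)) / d.
  elim: k => [|k IH]; first by rewrite addn0 subrr mul0r addr0 rough_zeta_small.
  rewrite addnS rough_zetaS.
  have : zeta_term (y.+1 + k).+1 <= (npow (y.+1 + k) - npow (y.+1 + k).+1) / d.
    by rewrite ler_pdivlMr // mulrC addSn zeta_term_le_diff.
  have := zeta_term_ge0 (y.+1 + k).+1.
  move: IH; rewrite !mulrBl; case: ifP => _; lra.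
apply: le_trans (_ : rough_zeta y.+2 (y.+1 + N) <= _).
  rewrite /rough_zeta [leRHS](big_cat_nat _ (n := N.+1)) ?ltnS ?leq_addl //=.
  by rewrite lerDl; apply: sumr_ge0 => n _; exact: zeta_term_ge0.
apply: le_trans (step N) _; rewrite lerD2l ler_wpM2r ?invr_ge0 ?(ltW d0) //.
by rewrite lerBlDr lerDl npow_ge0.
Qed.

Definition zeta : R := limn (rough_zeta 0).

Lemma cvg_zeta : rough_zeta 0 @ \oo --> zeta.
Proof.
apply: nondecreasing_is_cvgn.
  apply/nondecreasing_seqP => N.
  by rewrite rough_zetaS lerDl zeta_term_ge0.
exists (1 + npow 1 / d) => _ [N _ <-].
have -> : rough_zeta 0 N = rough_zeta 2 N by rewrite !rough_zeta_nonprime.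
exact: rough_zeta_le.
Qed.

(** The sieve step passes to the limit because [N %/ y] also tends to infinity; each prime
    contributes one Euler factor. *)
Lemma cvg_rough_zeta y :
  rough_zeta y @ \oo --> zeta * \prod_(0 <= p < y | prime p) (1 - zeta_term p).
Proof.
elim: y => [|y IH]; first by rewrite big_geq // mulr1; exact: cvg_zeta.
rewrite big_mkcond big_nat_recr //= -big_mkcond /=.
case: ifP => py; last first.
  rewrite mulr1; suff -> : rough_zeta y.+1 = rough_zeta y by [].
  by apply/funext => N; rewrite rough_zeta_nonprime // py.
have -> : rough_zeta y.+1 =
    (fun N => rough_zeta y N - zeta_term y * rough_zeta y (N %/ y)).
  by apply/funext => N; rewrite rough_zeta_prime.
set z := zeta * _ in IH *; rewrite mulrA -/z mulrBr mulr1 [z * _]mulrC.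
apply: cvgB => //; apply: cvgM; first exact: cvg_cst.
exact: (cvg_comp _ _ (cvg_divn_infty (prime_gt0 py)) IH).
Qed.

(** The product is the zeta sum over integers free of primes below y + 2: at least its term at 1,
    and at most the bound of [rough_zeta_le]. This is the Euler product with an explicit error. *)
Lemma euler_product_bounds y :
  1 <= zeta * \prod_(0 <= p < y.+2 | prime p) (1 - zeta_term p) <= 1 + npow y.+1 / d.
Proof.
apply/andP; split.
  apply: cvgr_to_ge (@cvg_rough_zeta y.+2) _.
  by exists 1%N => // N /= N1; apply: rough_zeta_ge1.
apply: cvgr_to_le (@cvg_rough_zeta y.+2) _.
by apply: nearW => N; exact: rough_zeta_le.
Qed.

Lemma zeta_ge1 : 1 <= zeta.
Proof.
have /andP[+ _] := euler_product_bounds 0; rewrite big_nat_cond big1 ?mulr1 // => p.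
by case/andP=> /andP[_ p2] /prime_gt1; rewrite ltnNge -ltnS p2.
Qed.

Lemma zeta_bounds : 1 <= d * zeta <= 1 + d.
Proof.
apply/andP; split; last first.
  have : zeta <= 1 + npow 1 / d.
    apply: cvgr_to_le cvg_zeta _; apply: nearW => N.
    have -> : rough_zeta 0 N = rough_zeta 2 N by rewrite !rough_zeta_nonprime.
    exact: rough_zeta_le.
  rewrite npow1 -(ler_pM2l d0) mulrDr mulr1 mulrCA mulfV ?gt_eqF // mulr1.
  by rewrite addrC.
have H N : 1 - npow N.+1 <= d * rough_zeta 0 N.
  elim: N => [|N IH].
    by rewrite npow1 subrr /rough_zeta big_geq // mulr0.
  rewrite rough_zetaS /=.
  by have := diff_le_zeta_term N; rewrite mulrDr; lra.
have L : rough_zeta 0 N * d @[N --> \oo] --> zeta * d.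
  by apply: cvgM; [exact: cvg_zeta|exact: cvg_cst].
(* Along powers of two [npow] is a geometric sequence, which gives its limit 0. *)
have Hz K : 1 - npow 2 ^+ K <= d * zeta.
  rewrite mulrC; apply: cvgr_to_ge L _; exists (2 ^ K)%N => // N /= KN.
  rewrite mulrC; apply: le_trans (H N); rewrite lerD2l lerN2 -npow_pow2.
  rewrite ler_expR !mulNr lerN2 ler_wpM2l ?(ltW d0) // ler_lnn ?expn_gt0 //.
  exact: leqW.
have L1 : 1 - npow 2 ^+ K @[K --> \oo] --> (1 - 0 : R).
  by apply: cvgB; [exact: cvg_cst|exact: cvg_npow2].
rewrite -[leLHS]subr0; apply: cvgr_to_le L1 _.
by apply: nearW.
Qed.

Lemma zeta_term_prime p : prime p -> zeta_term p <= p%:R^-1.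
Proof.
move=> pp; rewrite zeta_termE ?prime_gt0 // ler_piMr ?invr_ge0 //.
by rewrite expR_le1 mulNr oppr_le0 mulr_ge0 ?lnn_ge0 // ltW.
Qed.

Lemma recip_prime_le p : prime p -> p%:R^-1 <= 2^-1 :> R.
Proof. by move=> pp; rewrite lef_pV2 ?posrE ?ltr0n ?prime_gt0 // ler_nat prime_gt1. Qed.

Lemma euler_product_ln K :
  0 <= ln zeta + \sum_(0 <= p < (2 ^ K).+1 | prime p) ln (1 - zeta_term p)
    <= npow 2 ^+ K / d.
Proof.
have [y yK] : exists y, (2 ^ K)%N = y.+1.
  by exists (2 ^ K).-1; rewrite prednK // expn_gt0.
have t1 p : prime p -> 0 < 1 - zeta_term p.
  by move=> pp; have := zeta_term_prime pp; have := recip_prime_le pp; lra.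
have /andP[E1 E2] := euler_product_bounds y.
have z0 : 0 < zeta by have := zeta_ge1; lra.
have Pp : 0 < \prod_(0 <= p < y.+2 | prime p) (1 - zeta_term p).
  by apply: prodr_gt0 => p pp; apply: t1.
have -> : \sum_(0 <= p < (2 ^ K).+1 | prime p) ln (1 - zeta_term p) =
    ln (\prod_(0 <= p < (2 ^ K).+1 | prime p) (1 - zeta_term p)).
  suff [] : \sum_(0 <= p < (2 ^ K).+1 | prime p) ln (1 - zeta_term p) =
    ln (\prod_(0 <= p < (2 ^ K).+1 | prime p) (1 - zeta_term p)) /\
    0 < \prod_(0 <= p < (2 ^ K).+1 | prime p) (1 - zeta_term p) by [].
  elim/big_rec2: _ => [|p u v pp [-> v0]]; first by rewrite ln1.
  by rewrite lnM ?posrE ?t1 // mulr_gt0 ?t1.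
rewrite -npow_pow2 yK -lnM ?posrE // ln_ge0 //=.
apply: le_trans (_ : ln (1 + npow y.+1 / d) <= _).
  by rewrite ler_ln ?posrE ?mulr_gt0 // addr_gt0 // divr_gt0 ?expR_gt0.
apply: le_ln1Dx; apply: lt_le_trans (_ : 0 <= _); first by lra.
by rewrite divr_ge0 ?npow_ge0 // ltW.
Qed.

End EulerSieve.

(** * The value of the Mertens constant *)

(** This is the sum of u^k/k over k >= 2. At u = 1/p it is the term of the series in [mertens_c]; at
    u = p^(-1-d) it is what an Euler factor adds beyond u. *)
Definition log_defect (R : realType) (u : R) : R := - ln (1 - u) - u.

(** The derivative u/(1 - u) lies in [0, 1] for u in [0, 1/2]; the proof needs only ln(1 + s) <=
    s. *)
Lemma log_defect_lipschitz (R : realType) (u v : R) : 0 <= u -> u <= v -> v <= 2^-1 ->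
  0 <= log_defect v - log_defect u <= v - u.
Proof.
move=> u0 uv v2; rewrite /log_defect.
have E : ln (1 - u) - ln (1 - v) = ln (1 + (v - u) / (1 - v)).
  by rewrite -ln_div ?posrE; [congr ln; field|..]; lra.
have E' : ln (1 - v) - ln (1 - u) = ln (1 + - ((v - u) / (1 - u))).
  by rewrite -ln_div ?posrE; [congr ln; field|..]; lra.
have q1 : (v - u) / (1 - v) <= 2 * (v - u).
  by rewrite ler_pdivrMr; [nra|lra].
have q0 : 0 <= (v - u) / (1 - v) by rewrite divr_ge0; lra.
have q2 : v - u <= (v - u) / (1 - u) by rewrite ler_pdivlMr; [nra|lra].
have q3 : (v - u) / (1 - u) < 1 by rewrite ltr_pdivrMr; lra.
have := @le_ln1Dx R ((v - u) / (1 - v)) ltac:(lra).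
have := @le_ln1Dx R (- ((v - u) / (1 - u))) ltac:(lra).
rewrite -E -E' => H1 H2; apply/andP; split; lra.
Qed.

Lemma log_defect_ge0 (R : realType) (v : R) : 0 <= v -> v <= 2^-1 -> 0 <= log_defect v.
Proof.
move=> v0 v2; have /andP[+ _] := log_defect_lipschitz (lexx 0) v0 v2.
have -> : log_defect (0 : R) = 0 by rewrite /log_defect !subr0 ln1 oppr0.
by rewrite subr0.
Qed.

Section MertensConstant.
Variable R : realType.
Local Notation lnn n := (ln (n%:R : R)).

Definition defect_sum (n : nat) : R :=
  \sum_(0 <= p < n | prime p) log_defect (p%:R^-1 : R).

Lemma log_defect_prime_ge0 p : prime p -> 0 <= log_defect (p%:R^-1 : R).
Proof. by move=> pp; rewrite log_defect_ge0 ?invr_ge0 ?recip_prime_le. Qed.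

Lemma nondecreasing_defect_sum : nondecreasing_seq defect_sum.
Proof.
apply/nondecreasing_seqP => n; rewrite /defect_sum prime_sum_recr lerDl.
by case: ifP => // pn; rewrite log_defect_prime_ge0.
Qed.

(** The term at p is at most 1/(p - 1) - 1/p, which telescopes. *)
Lemma is_cvg_defect_sum : cvgn defect_sum.
Proof.
apply: nondecreasing_is_cvgn; first exact: nondecreasing_defect_sum.
exists 1 => _ [n _ <-].
apply: le_trans (nondecreasing_defect_sum (ltnW (leqnSn n.+1))) _.
apply: le_trans (_ : 1%:R^-1 - n.+1%:R^-1 <= _); last first.
  by rewrite invr1 lerBlDr lerDl invr_ge0.
apply: (@prime_sum_le_telescope R _ (fun k => k%:R^-1)) => -[//|k] _.
  move=> _; rewrite /log_defect lerD2r.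
  have -> : 1 - k.+2%:R^-1 = k.+1%:R / k.+2%:R :> R.
    rewrite -[k.+2%:R]natr1; have : 0 < k.+1%:R :> R by rewrite ltr0n.
    by move: (k.+1%:R : R) => x x0; field; lra.
  by rewrite ln_div ?posrE ?ltr0n // opprB; exact: ln_inv_pred_le.
by rewrite lef_pV2 ?posrE ?ltr0n // ler_nat.
Qed.

Section FixedExponent.
Variable d : R.
Hypothesis d0 : 0 < d.
Let x : R := npow d 2.

Lemma npow_dyadic k p : prime p -> (2 ^ k < p)%N -> (p <= 2 ^ k.+1)%N ->
  x ^+ k.+1 <= npow d p <= x ^+ k.
Proof.
move=> pp kp pk; rewrite -!npow_pow2 /npow !ler_expR !mulNr !lerN2.
by rewrite !ler_wpM2l ?(ltW d0) // ler_lnn ?expn_gt0 ?prime_gt0 // ltnW.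
Qed.

Lemma dyadic_zeta_term k :
  dyadic_recip R k * x ^+ k.+1 <= dyadic_sum (zeta_term d) k <= dyadic_recip R k * x ^+ k.
Proof.
rewrite /dyadic_recip {1 3}/dyadic_sum !mulr_suml; apply/andP; split.
  apply: ler_dyadic_sum => p pp kp pk; rewrite zeta_termE ?prime_gt0 //.
  by rewrite ler_wpM2l ?invr_ge0 //; case/andP: (npow_dyadic pp kp pk).
apply: ler_dyadic_sum => p pp kp pk; rewrite zeta_termE ?prime_gt0 //.
by rewrite ler_wpM2l ?invr_ge0 //; case/andP: (npow_dyadic pp kp pk).
Qed.

(** On the k-th block p^(-d) lies between x^(k+1) and x^k, where x = 2^(-d), so replacing it by
    x^(k+1) loses at most a factor x. *)
Lemma prime_zeta_dyadic K :
  let F := \sum_(0 <= p < (2 ^ K).+1 | prime p) zeta_term d p in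
  let V := \sum_(0 <= k < K) dyadic_recip R k * x ^+ k.+1 in
  V <= F /\ x * F <= V.
Proof.
move=> F V; rewrite /F /V prime_sum_dyadic; split.
  by apply: ler_sum => k _; case/andP: (dyadic_zeta_term k).
rewrite mulr_sumr; apply: ler_sum => k _; rewrite exprS mulrCA.
by rewrite ler_wpM2l ?npow_ge0 //; case/andP: (dyadic_zeta_term k).
Qed.

Lemma defect_zeta_term p : prime p ->
  0 <= log_defect (p%:R^-1 : R) - log_defect (zeta_term d p) <= d.
Proof.
move=> pp.
have /andP[H1 H2] := log_defect_lipschitz (zeta_term_ge0 d p)
  (zeta_term_prime d0 pp) (recip_prime_le R pp).
rewrite H1 /=; apply: le_trans H2 _.
have p0 : 0 < p%:R :> R by rewrite ltr0n prime_gt0.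
rewrite zeta_termE ?prime_gt0 //.
have : 1 - d * lnn p <= npow d p by rewrite -mulNr expR_ge1Dx.
have : lnn p <= p%:R by rewrite ltW // ln_sublinear.
move=> lp np; rewrite -{1}[p%:R^-1]mulr1 -mulrBr mulrC ler_pdivrMr //.
apply: le_trans (_ : d * lnn p <= _); first by lra.
by rewrite ler_wpM2l // ltW.
Qed.

Lemma log_defect_zeta_term_ge0 p : prime p -> 0 <= log_defect (zeta_term d p).
Proof.
move=> pp; apply: log_defect_ge0; first exact: zeta_term_ge0.
exact: le_trans (zeta_term_prime d0 pp) (recip_prime_le R pp).
Qed.

(** The lower bound serves at a fixed [n] as d tends to 0; the upper bound is uniform in [n]. *)
Lemma defect_zeta_sum n :
  defect_sum n - d * n%:R <=
  \sum_(0 <= p < n | prime p) log_defect (zeta_term d p) <= defect_sum n.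
Proof.
elim: n => [|n /andP[IH1 IH2]].
  by rewrite /defect_sum !big_geq // mulr0 subr0 lexx.
rewrite /defect_sum !prime_sum_recr -/(defect_sum n) -natr1 mulrDr mulr1.
have d_gt0 := d0; case: ifP => pn; last by apply/andP; split; lra.
by have /andP[H1 H2] := defect_zeta_term pn; apply/andP; split; lra.
Qed.

Lemma ln_zeta_bounds : 0 <= ln (zeta d) + ln d <= d.
Proof.
have /andP[z1 z2] := zeta_bounds d0; have z0 := zeta_ge1 d0; have d_gt0 := d0.
rewrite addrC -lnM ?posrE //; last by lra.
rewrite ln_ge0 //=; apply: le_trans (_ : ln (1 + d) <= _).
  by rewrite ler_ln ?posrE; lra.
by apply: le_ln1Dx; lra.
Qed.

Lemma ln_one_sub_npow2 :
  - (d * ln 2) <= ln (1 - x) - ln (d * ln 2) <= 0.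
Proof.
set t := d * ln 2; have t0 : 0 < t by rewrite mulr_gt0 // ln_gt0 // ltr1n.
have xt : x = expR (- t) by rewrite /x /npow mulNr.
have x1 : x < 1 := npow2_lt1 d0.
have ub : 1 - x <= t by have := expR_ge1Dx (- t); rewrite -xt; lra.
have lb : t / (1 + t) <= 1 - x.
  have e0 := expR_gt0 t; have := expR_ge1Dx t => et.
  have : x <= (1 + t)^-1 by rewrite xt expRN lef_pV2 ?posrE; lra.
  have -> : t / (1 + t) = 1 - (1 + t)^-1 by field; lra.
  lra.
apply/andP; split; last by rewrite subr_le0 ler_ln ?posrE; lra.
have : ln (t / (1 + t)) <= ln (1 - x).
  by rewrite ler_ln ?posrE ?divr_gt0 //; lra.
rewrite ln_div ?posrE; [|lra|lra].
have := @le_ln1Dx R t ltac:(lra); lra.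
Qed.

End FixedExponent.

(** With x = 2^(-d), up to small errors: L is V - Lam, V is F, F + G is ln zeta(1+d), that is -ln d,
    G is H, and Lam is -ln(1 - x), that is -ln d - ln(ln 2). The terms ln d cancel. *)
Lemma dyadic_limit_value (L H : R) :
  (prime_recip_sum R (2 ^ K) - series harmonic K) @[K --> \oo] --> L ->
  defect_sum @ \oo --> H -> L = ln (ln 2) - H.
Proof.
move=> DL defH.
apply/eqP; rewrite -subr_eq0 -normr_le0; apply/ler_addgt0Pl => e' e'0; rewrite addr0.
(* Nine times [e] leaves room for all the errors collected in the last step. *)
pose e := e' / 9; have e0 : 0 < e by rewrite /e; lra.
have [eta eta0 abel] := abel_summation_eps (D := fun K =>
  prime_recip_sum R (2 ^ K) - series harmonic K) ltac:(by rewrite /prime_recip_sum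
  prime_sum_lt2 // seriesEnat /= big_geq // subr0) DL e0.
have Hle n : defect_sum n <= H.
  rewrite -(cvg_lim _ defH) //.
  exact: nondecreasing_cvgn_le nondecreasing_defect_sum is_cvg_defect_sum n.
have /cvgrPdist_le/(_ _ e0)[n0 _ /(_ n0 (leqnn _)) Hn0] := defH.
have {Hn0} : H - e <= defect_sum n0 by move: Hn0; rewrite ler_norml => /andP[_]; lra.
move=> Hn0.
have [q [q0 q1 qe qn qeta]] : exists q : R,
    [/\ 0 < q, q <= 1, q <= e / 2, q * n0%:R <= e & q < eta].
  have n1 : 0 < n0%:R + 1 :> R by rewrite natr1 ltr0n.
  pose q := Num.min (Num.min 1 (e / 2)) (Num.min (e / (n0%:R + 1)) (eta / 2)).
  have q0 : 0 < q by rewrite !lt_min ltr01 !divr_gt0.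
  have : q <= e / (n0%:R + 1) by rewrite /q !ge_min lexx !orbT.
  rewrite ler_pdivlMr // => qn.
  exists q; split => //.
  - by rewrite /q !ge_min lexx.
  - by rewrite /q !ge_min lexx !orbT.
  - by nra.
  - by apply: le_lt_trans (_ : eta / 2 < _); [rewrite /q !ge_min lexx !orbT|lra].
(* Taking d = q^2 gives -d ln d <= 2 q from ln(1/q) <= 1/q. This controls F - V <= d F, where F may
   be as large as -ln d + d. *)
pose d := q ^+ 2; have d0 : 0 < d by rewrite exprn_gt0.
have dq : d <= q by rewrite /d expr2; nra.
have lnd : - d * ln d <= 2 * q.
  rewrite {2}/d lnXn // -mulr_natl.
  have : - ln q <= q^-1.
    by rewrite -lnV ?posrE // ltW // ln_sublinear // invr_gt0.
  rewrite -(ler_pM2l (_ : 0 < 2 * d)); last by lra.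
  have -> : 2 * d * q^-1 = 2 * q by rewrite /d; field; lra.
  lra.
pose t := d * ln 2; pose x := npow d 2.
have ln2 := ln2_gt0 R.
have ln21 := ln2_le1 R.
have td : 0 < t <= d by rewrite /t mulr_gt0 //=; nra.
case/andP: td => t0 td.
have xt : x = expR (- t) by rewrite /x /npow mulNr.
have x0 : 0 < x by rewrite xt expR_gt0.
have x1 : x < 1 := npow2_lt1 d0.
have xd : 1 - x <= d by have := expR_ge1Dx (- t); rewrite -xt; lra.
have small c : 0 < c -> \forall K \near \oo, x ^+ K / c <= e.
  move=> c0; have ec : 0 < e * c by rewrite mulr_gt0.
  have /cvgr0Pnorm_le/(_ _ ec) := cvg_npow2 d0.
  apply: filterS => K; rewrite ger0_norm ?exprn_ge0 ?npow_ge0 // => xK.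
  by rewrite ler_pdivrMr.
have x10 : 0 < 1 - x by lra.
have big_n0 : \forall K \near \oo, (n0 <= (2 ^ K).+1)%N.
  exists n0 => // K /= n0K; apply: leq_trans n0K _.
  by rewrite leqW // ltnW // ltn_expl.
have x_eta : 1 - eta < x.
  by rewrite ltrBlDr -ltrBlDl (le_lt_trans xd) // (le_lt_trans dq).
(* As d is now fixed, a single [K] serves Abel's theorem, both geometric errors and the cutoff
   [n0]. *)
have [K [[/= HU H1] [H2 H3]]] := filter_ex (filterI (filterI
  (abel x x0 x_eta x1) (small _ x10)) (filterI (small _ d0) big_n0)).
pose F := \sum_(0 <= p < (2 ^ K).+1 | prime p) zeta_term d p.
pose V := \sum_(0 <= k < K) dyadic_recip R k * x ^+ k.+1.
pose G := \sum_(0 <= p < (2 ^ K).+1 | prime p) log_defect (zeta_term d p).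
pose Lam := \sum_(0 <= k < K) x ^+ k.+1 / k.+1%:R.
have VU : \sum_(0 <= k < K) ((prime_recip_sum R (2 ^ k.+1) - series harmonic k.+1) -
   (prime_recip_sum R (2 ^ k) - series harmonic k)) * x ^+ k.+1 = V - Lam.
  rewrite /V /Lam -sumrB; apply: eq_bigr => k _.
  rewrite /prime_recip_sum !prime_sum_dyadic big_nat_recr //= seriesSr /harmonic /=.
  rewrite -/(dyadic_recip R k); ring.
rewrite VU in HU.
have [VF FV] := prime_zeta_dyadic d0 K; rewrite -/F -/V -/x in VF FV.
have /andP[E1 E2] := euler_product_ln d0 K.
have EG : \sum_(0 <= p < (2 ^ K).+1 | prime p) ln (1 - zeta_term d p) = - (G + F).
  rewrite /G /F -big_split /= -sumrN; apply: eq_bigr => p _.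
  by rewrite /log_defect; ring.
rewrite EG -/x in E1 E2.
have /andP[Z1 Z2] := ln_zeta_bounds d0.
have x01 : 0 <= x < 1 by rewrite (ltW x0).
have /andP[S1 S2] := ln_series_remainder K x01.
rewrite -/Lam in S1 S2.
have /andP[hO1 hO2] := ln_one_sub_npow2 d0; rewrite -/t -/x in hO1 hO2.
have lnt : ln t = ln d + ln (ln 2) by rewrite lnM.
have /andP[_ G1] := defect_zeta_sum d0 (2 ^ K).+1; rewrite -/G in G1.
have /andP[G2 _] := defect_zeta_sum d0 n0.
(* The sum is cut at [n0], where replacing p^(-1-d) by 1/p costs at most d n0 <= e; at 2^K the cost
   d 2^K would not be small. *)
have G3 : \sum_(0 <= p < n0 | prime p) log_defect (zeta_term d p) <= G.
  rewrite /G [leRHS](big_cat_nat _ (n := n0)) //= lerDl; apply: sumr_ge0 => p pp.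
  exact: log_defect_zeta_term_ge0.
have G0 : 0 <= G by apply: sumr_ge0 => p; exact: log_defect_zeta_term_ge0.
have F0 : 0 <= F by apply: sumr_ge0 => p _; exact: zeta_term_ge0.
have HH := Hle (2 ^ K).+1.
have dn : d * n0%:R <= e.
  by apply: le_trans qn; rewrite ler_wpM2r.
have Fd : F <= - ln d + d by lra.
have FV2 : F - V <= 2 * e.
  have A1 : F - V <= (1 - x) * F by lra.
  have A2 : (1 - x) * F <= d * F by rewrite ler_wpM2r.
  have A3 : d * F <= d * (- ln d + d) by rewrite ler_wpM2l // ltW.
  have A4 : d * d <= d by nra.
  lra.
move: HU; rewrite ler_norml => /andP[U1 U2].
have -> : e' = 9 * e by rewrite /e; field.
have te : t <= e by lra.
have de : d <= e by lra.
clear -e0 U1 U2 H1 H2 VF FV2 E1 E2 Z1 Z2 S1 S2 hO1 hO2 lnt G1 G2 G3 HH dn Hn0 te de.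
by rewrite ler_norml; apply/andP; split; lra.
Qed.

End MertensConstant.

(** * Asymptotics of the partial sums *)

Section Asymptotics.
Variable R : realType.
Local Notation lnn n := (ln (n%:R : R)).

Definition perm_ratio (n : nat) : R := (P n)%:R / n`!%:R.

Lemma perm_ratio0 : perm_ratio 0 = 1.
Proof. by rewrite /perm_ratio P0 fact0 divr1. Qed.

Lemma perm_ratio_rec n : n.+1%:R * perm_ratio n.+1 =
  \sum_(j < n.+1) (prime j.+1)%:R * perm_ratio (n - j).
Proof.
have f0 m : m`!%:R != 0 :> R by rewrite pnatr_eq0 -lt0n fact_gt0.
rewrite /perm_ratio factS natrM invfM mulrCA mulVKf ?pnatr_eq0 //.
rewrite P_rec natr_sum mulr_suml; apply: eq_bigr => j _.
case: ifP => _; last by rewrite muln0 !mul0r.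
rewrite mul1r -(bin_fact (_ : j <= n)%N); last by rewrite -ltnS.
have c0 : 'C(n, j)%:R != 0 :> R by rewrite pnatr_eq0 -lt0n bin_gt0 -ltnS.
rewrite !natrM; have := f0 j; have := f0 (n - j)%N => h1 h2.
by field; rewrite h1 h2.
Qed.

(** Primes above 2^j have ln p >= j ln 2, so Chebyshev's bound leaves at most (2/j) 2^K of them.
    Choose j with 2/j <= e/2, then K so large that the numbers up to 2^j are negligible. *)
Lemma prime_count_dyadic_small (e : R) : 0 < e -> \forall K \near \oo,
  \sum_(0 <= p < (2 ^ K).+1 | prime p) (1 : R) <= e * 2 ^+ K.
Proof.
move=> e0.
have ln2 := ln2_gt0 R.
have e2 : 0 < e / 4 by lra.
have e3 : 0 < e / 2 by lra.
have /cvgr0Pnorm_le/(_ _ e2)[J _ /(_ J (leqnn J)) HJ] := @cvg_harmonic R.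
pose j := J.+1; have j0 : 0 < j%:R :> R by rewrite ltr0n.
have {}HJ : j%:R^-1 <= e / 4 by apply: le_trans HJ; rewrite ger0_norm // harmonic_ge0.
have c0 : 0 < e / 2 / ((2 ^ j).+1%:R) by rewrite divr_gt0.
have half1 : `|2^-1 : R| < 1 by rewrite ger0_norm; lra.
have /cvgr0Pnorm_le/(_ _ c0) := cvg_expr half1.
move=> [K0 _ HK0]; exists (maxn K0 j) => // K /=; rewrite geq_max => /andP[K0K jK].
have {}HK0 : (2 ^ j).+1%:R <= e / 2 * 2 ^+ K.
  have := HK0 K K0K; rewrite ger0_norm ?exprn_ge0 ?invr_ge0 // exprVn.
  rewrite ler_pdivlMr ?ltr0n // mulrC ler_pdivrMr ?exprn_gt0 //.
rewrite (big_cat_nat _ (n := (2 ^ j).+1)) ?ltnS ?leq_pexp2l //=.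
have A1 : \sum_(0 <= p < (2 ^ j).+1 | prime p) (1 : R) <= (2 ^ j).+1%:R.
  apply: le_trans (_ : \sum_(0 <= p < (2 ^ j).+1) (1 : R) <= _).
    by rewrite big_mkcond; apply: ler_sum => p _; case: ifP.
  by rewrite big_const_nat subn0 iter_addr_0.
have A2 : \sum_((2 ^ j).+1 <= p < (2 ^ K).+1 | prime p) (1 : R) <=
    (j%:R * ln 2)^-1 * (2 ^+ K.+1 * ln 2).
  apply: le_trans (_ : (j%:R * ln 2)^-1 *
     \sum_(0 <= p < (2 ^ K).+1 | prime p) lnn p <= _); last first.
    by rewrite ler_wpM2l ?chebyshev_theta // invr_ge0 mulr_ge0 // ltW.
  rewrite [X in _ <= _ * X](big_cat_nat _ (n := (2 ^ j).+1)) ?ltnS ?leq_pexp2l //=.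
  rewrite mulrDr -[leLHS]add0r; apply: lerD.
    by rewrite mulr_ge0 ?invr_ge0 ?mulr_ge0 ?(ltW ln2) // sumr_ge0 // => p _;
      rewrite lnn_ge0.
  rewrite mulr_sumr big_nat_cond [leRHS]big_nat_cond.
  apply: ler_sum => p /andP[/andP[jp _] _].
  rewrite ler_pdivlMl ?mulr_gt0 // mulr1 -lnn_pow2 ler_lnn ?expn_gt0 //.
  exact: ltnW.
have A3 : (j%:R * ln 2)^-1 * (2 ^+ K.+1 * ln 2) = 2 * j%:R^-1 * 2 ^+ K :> R.
  by rewrite exprS; field; rewrite !gt_eqF.
have A4 : 2 * j%:R^-1 * 2 ^+ K <= e / 2 * 2 ^+ K.
  by rewrite ler_wpM2r ?exprn_ge0 //; lra.
rewrite A3 in A2; have -> : e * 2 ^+ K = e / 2 * 2 ^+ K + e / 2 * 2 ^+ K by field.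
by apply: lerD => //; [exact: le_trans A1 _|exact: le_trans A2 _].
Qed.

Definition perm_ratio_sum (n : nat) : R := \sum_(0 <= k < n.+1) perm_ratio k.

Lemma perm_ratio_sum_dyadic_ge (e : R) : 0 < e -> \forall K \near \oo,
  (1 - e) * expR (prime_recip_sum R (2 ^ K)) <= perm_ratio_sum (2 ^ K).
Proof.
(* This [T] makes e^(-T) <= 1/(1 + T) at most half of the allowed error; the prime count takes the
   other half. *)
move=> e0; pose T : R := 2 / e; have T0 : 0 < T by rewrite divr_gt0.
have eT : expR (- T) <= e / 2.
  rewrite expRN -[e / 2]invrK lef_pV2 ?posrE ?expR_gt0 ?invr_gt0 ?divr_gt0 //.
  by rewrite invf_div; have := expR_ge1Dx T; rewrite -/T; lra.
have eT0 : 0 < e / 2 / T by rewrite !divr_gt0.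
apply: filterS (prime_count_dyadic_small eT0) => K.
set n := (2 ^ K)%N; have n0 : 0 < n%:R :> R by rewrite ltr0n expn_gt0.
rewrite -natrX -/n; set pc := \sum_(_ <= _ < _ | _) _ => pcK.
pose x : R := expR (- (T / n%:R)).
have x01 : 0 <= x <= 1 by rewrite expR_ge0 expR_le1 oppr_le0 divr_ge0 // ltW.
have xn : x ^+ n = expR (- T) by rewrite -expRM_natl mulrN mulrC divfK ?gt_eqF.
have := expR_prime_poly_le perm_ratio0 perm_ratio_rec n x01.
rewrite -/(perm_ratio_sum n) xn; set A := prime_recip_sum R n => up.
have gx : A - e / 2 <= (prime_poly R n).[x].
  (* Since x^p >= 1 - p T/n, each prime loses at most T/n from its term 1/p. *)
  apply: le_trans (_ : A - T / n%:R * pc <= _).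
    rewrite lerD2l lerN2 mulrAC ler_pdivrMr //.
    move: pcK; rewrite -(ler_pM2l T0) => /le_trans; apply.
    by rewrite mulrA mulrCA mulfV ?mulr1 ?gt_eqF.
  rewrite horner_prime_poly /A /prime_recip_sum /pc mulr_sumr -sumrB.
  apply: ler_sum => p pp; have p0 : 0 < p%:R :> R by rewrite ltr0n prime_gt0.
  rewrite mulr1 /x -expRM_natl.
  apply: le_trans (_ : p%:R^-1 * (1 + p%:R * - (T / n%:R)) <= _); last first.
    by rewrite ler_wpM2l ?invr_ge0 // expR_ge1Dx.
  by rewrite mulrDr mulr1 mulrN mulrN mulKf ?gt_eqF.
have : expR (A - e / 2) <= expR (prime_poly R n).[x] by rewrite ler_expR.
rewrite expRD; have A0 := expR_gt0 A; have e1 := expR_ge1Dx (- (e / 2)) => Ax.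
have B1 : expR A * (1 - e / 2) <= expR A * expR (- (e / 2)) by rewrite ler_wpM2l // ltW.
have B2 : expR (- T) * expR A <= e / 2 * expR A by rewrite ler_wpM2r // ltW.
have -> : (1 - e) * expR A = expR A * (1 - e / 2) - e / 2 * expR A by field.
lra.
Qed.

Lemma cvg_perm_ratio_sum_dyadic :
  perm_ratio_sum (2 ^ K) / expR (prime_recip_sum R (2 ^ K)) @[K --> \oo] --> (1 : R).
Proof.
apply/cvgrPdist_le => e e0; apply: filterS (perm_ratio_sum_dyadic_ge e0) => K H.
have A0 := expR_gt0 (prime_recip_sum R (2 ^ K)).
have := prime_rec_sum_le perm_ratio0 perm_ratio_rec (2 ^ K).
rewrite -/(perm_ratio_sum _) => U.
have H1 : 1 - e <= perm_ratio_sum (2 ^ K) / expR (prime_recip_sum R (2 ^ K)).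
  by rewrite ler_pdivlMr.
have H2 : perm_ratio_sum (2 ^ K) / expR (prime_recip_sum R (2 ^ K)) <= 1.
  by rewrite ler_pdivrMr // mul1r.
by rewrite ler_norml; apply/andP; split; lra.
Qed.

Lemma mertens_cE : mertens_c R = euler_gamma R - limn (@defect_sum R).
Proof.
rewrite /mertens_c; congr (_ - limn _); apply/funext => n.
rewrite /defect_sum; apply: eq_bigr => p pp; rewrite !div1r /log_defect lnV //.
by rewrite posrE subr_gt0 invf_lt1 ?ltr0n ?ltr1n ?prime_gt0 ?prime_gt1.
Qed.

(** As ln(ln(2^K)) = ln K + ln(ln 2), this is Mertens' second theorem at 2^K; Euler's constant
    enters through the harmonic sum. *)
Lemma mertens_second_dyadic :
  prime_recip_sum R (2 ^ K) - lnn K @[K --> \oo] --> mertens_c R + ln (ln 2).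
Proof.
have /cvg_ex[L DL] := @is_cvg_dyadic_recip_sum R.
have LE := dyadic_limit_value DL (@is_cvg_defect_sum R).
have -> : mertens_c R + ln (ln 2) = L + euler_gamma R by rewrite mertens_cE LE; ring.
have -> : (fun K => prime_recip_sum R (2 ^ K) - lnn K) =
  (fun K => (prime_recip_sum R (2 ^ K) - series harmonic K) +
            (series harmonic K - lnn K)).
  by apply/funext => K; rewrite addrA subrK.
exact: cvgD DL (@is_cvg_euler_gamma R).
Qed.

Lemma cvg_perm_ratio_sum_pow2 :
  perm_ratio_sum (2 ^ K) / (expR (mertens_c R) * (K%:R * ln 2)) @[K --> \oo] --> (1 : R).
Proof.
have ln2 := ln2_gt0 R.
have E : expR (prime_recip_sum R (2 ^ K) - lnn K) @[K --> \oo] -->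
    expR (mertens_c R) * ln 2.
  have -> : expR (mertens_c R) * ln 2 = expR (mertens_c R + ln (ln 2)).
    by rewrite expRD lnK.
  by apply: continuous_cvg; [exact: continuous_expR|exact: mertens_second_dyadic].
have c0 : expR (mertens_c R) * ln 2 != 0 by rewrite mulf_neq0 // gt_eqF // expR_gt0.
rewrite -[X in _ --> X](_ : 1 * ((expR (mertens_c R) * ln 2) /
  (expR (mertens_c R) * ln 2)) = 1); last by rewrite mul1r mulfV.
apply: cvg_trans (cvgM cvg_perm_ratio_sum_dyadic (cvgM E (@cvg_cst _ _ _ _ _))).
apply: near_eq_cvg; exists 1%N => // K /= K1.
have K0 : 0 < K%:R :> R by rewrite ltr0n.
rewrite expRD expRN lnK ?posrE //.
by field; rewrite !gt_eqF ?expR_gt0.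
Qed.

End Asymptotics.

(** For 2^K <= n < 2^(K+1), monotonicity encloses the ratio between its values at the two powers of
    two, corrected by K/(K + 1) = 1 - [harmonic K] or its inverse, which tend to 1. *)
Theorem theorem1 (R : realType) :
  (\sum_(0 <= k < n.+1) ((P k)%:R / k`!%:R : R))
    / (expR (mertens_c R) * ln n%:R) @[n --> \oo] --> (1 : R).
Proof.
have ln2 := ln2_gt0 R.
have c0 : 0 < expR (mertens_c R) by exact: expR_gt0.
pose u (K : nat) : R := perm_ratio_sum R (2 ^ K) / (expR (mertens_c R) * (K%:R * ln 2)).
have h1 : (1 - harmonic K : R) @[K --> \oo] --> (1 : R).
  rewrite -[X in _ --> X]subr0; apply: cvgB; [exact: cvg_cst|exact: cvg_harmonic].
have lo : u K * (1 - harmonic K) @[K --> \oo] --> (1 : R).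
  rewrite -[X in _ --> X]mulr1; apply: cvgM => //; exact: cvg_perm_ratio_sum_pow2.
have up : u K.+1 / (1 - harmonic K) @[K --> \oo] --> (1 : R).
  rewrite -[X in _ --> X]mulr1 -[X in _ * X]invr1; apply: cvgM; last exact: cvgV.
  by rewrite cvg_shiftS; exact: cvg_perm_ratio_sum_pow2.
have tl : trunc_log 2 n @[n --> \oo] --> \oo.
  apply/cvgnyPge => k; exists (2 ^ k)%N => // n /= kn.
  exact: trunc_log_max.
apply: (squeeze_cvgr _ (cvg_comp _ _ tl lo) (cvg_comp _ _ tl up)).
(* From n = 2 on, [K] is positive, so ln n and K/(K + 1) are positive and may be divided by. *)
exists 2%N => // n /= n2; set K := trunc_log 2 n.
have K1 : (0 < K)%N by rewrite trunc_log_gt0.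
have K0 : 0 < K%:R :> R by rewrite ltr0n.
have Kn : (2 ^ K <= n)%N by rewrite trunc_logP // (leq_trans _ n2).
have nK : (n < 2 ^ K.+1)%N by exact: trunc_log_ltn.
have S0 m : 0 <= perm_ratio_sum R m.
  by apply: sumr_ge0 => k _; rewrite divr_ge0.
have Smono m m' : (m <= m')%N -> perm_ratio_sum R m <= perm_ratio_sum R m'.
  move=> mm; rewrite /perm_ratio_sum [leRHS](big_cat_nat _ (n := m.+1)) //= lerDl.
  by apply: sumr_ge0 => k _; rewrite divr_ge0.
rewrite -/(perm_ratio_sum R n) /harmonic /=.
have hE : 1 - K.+1%:R^-1 = K%:R / K.+1%:R :> R.
  by rewrite -[K.+1%:R]natr1; field; rewrite gt_eqF // ltr_wpDl.
have l1 : K%:R * ln 2 <= ln (n%:R : R).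
  by rewrite -lnn_pow2 ler_lnn // expn_gt0.
have l2 : ln (n%:R : R) <= K.+1%:R * ln 2.
  by rewrite -lnn_pow2 ler_lnn // ltnW // (leq_trans _ n2).
have ln0 : 0 < ln (n%:R : R) by apply: lt_le_trans l1; rewrite mulr_gt0.
rewrite hE /u; apply/andP; split.
  have -> : perm_ratio_sum R (2 ^ K) / (expR (mertens_c R) * (K%:R * ln 2)) *
     (K%:R / K.+1%:R) =
     perm_ratio_sum R (2 ^ K) / (expR (mertens_c R) * (K.+1%:R * ln 2)).
    by rewrite !invfM; field; rewrite !gt_eqF.
  apply: ler_pM; rewrite ?invr_ge0 ?mulr_ge0 ?(ltW c0) ?(ltW ln2) ?Smono //.
  by rewrite lef_pV2 ?posrE ?mulr_gt0 // ler_pM2l.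
have -> : perm_ratio_sum R (2 ^ K.+1) / (expR (mertens_c R) * (K.+1%:R * ln 2)) /
   (K%:R / K.+1%:R) =
   perm_ratio_sum R (2 ^ K.+1) / (expR (mertens_c R) * (K%:R * ln 2)).
  by rewrite !invfM; field; rewrite !gt_eqF.
apply: ler_pM; rewrite ?invr_ge0 ?mulr_ge0 ?(ltW c0) ?(ltW ln0) ?Smono //.
  exact: ltnW.
by rewrite lef_pV2 ?posrE ?mulr_gt0 // ler_pM2l.
Qed.
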